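(* Not all three-dimensional hexahedral meshes allow for a consistent edge orientation. In particular: (a) There is a subdivision of a toroidal domain into hexahedra for which no consistent edge orientation exists. Take a string of hexahedral cells, bend it into a torus and attach its two ends. Without a twist, the resulting mesh has a consistent edge orientation. If the string is twisted by $180^\circ$ before the ends are attached, no consistent edge orientation exists. The same non-existence holds for a twist of $90^\circ$. (b) A hexahedral mesh with no consistent edge orientation need not have a hole or be multiply connected: there is a subdivision of a simply connected domain without holes into 14 hexahedra for which no consistent edge orientation exists.
   Context: A hexahedral mesh is a finite collection $\mathbb{T}=\{K_1,\ldots,K_{N}\}$ of hexahedral cells, regarded as open subsets of $\mathbb{R}^3$, that subdivides a bounded open domain $\Omega\subset\mathbb{R}^3$ (not required to be simply connected). This means that $K_i\cap K_j=\emptyset$ for $i\neq j$; that for $i\neq j$ the intersection $\bar K_i\cap\bar K_j$ of the closures is either empty, a vertex of the mesh, or a complete edge or complete face of both cells; and that $\bigcup_i\bar K_i=\bar\Omega$. Each cell is assumed to have positive volume and to be convex. Each cell has the 8 vertices, 12 edges and 6 quadrilateral faces of a combinatorial cube. Its twelve edges fall into three classes of four parallel edges each, corresponding to the three classes of parallel edges of the cube. A string of cells is a sequence of hexahedra in a row, each attached to the next along a complete face, these faces being opposite each other within each cell. Attaching the ends means identifying the free face of the last cell with the free face of the first cell. A consistent edge orientation of the mesh is an assignment of one direction to every edge of the mesh (the same direction for all cells containing that edge) such that, in every cell and for each of its three classes of parallel edges, the four edges of the class all point in the same direction, where direction is compared as for the corresponding parallel edges of the cube. *)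

(* Defs.v *)
From HB Require Import structures.
From mathcomp Require Import all_boot all_order all_algebra.
From mathcomp Require Import all_classical all_reals all_analysis.
Import Order.TTheory GRing.Theory Num.Theory.
Import numFieldNormedType.Exports.

Set Implicit Arguments.
Unset Strict Implicit.
Unset Printing Implicit Defensive.

Local Open Scope classical_set_scope.
Local Open Scope ring_scope.

(** * The combinatorial cube *)

Definition cube_vertex : Type := {ffun 'I_3 -> bool}.

Definition setc (x : cube_vertex) (d : 'I_3) (b : bool) : cube_vertex :=
  [ffun e => if e == d then b else x e].

(* The face of the cube through [x] spanned by the axes in [D]: a vertex, an
   edge or a quadrilateral when [D] has 0, 1 or 2 elements. *)
Definition cube_face (D : {set 'I_3}) (x : cube_vertex) : set cube_vertex :=
  [set y | forall d : 'I_3, d \notin D -> y d = x d].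

(** * Hexahedra *)

(* A cell is given by its eight vertices, labelled by the vertices of the cube.
   The labelling is arbitrary up to the 48 symmetries of the cube; these permute
   the three classes of parallel edges and preserve, or reverse simultaneously,
   the directions within a class, so the notion of consistent orientation below
   does not depend on it. *)
Definition hexa (R : realType) : Type := cube_vertex -> 'rV[R]_3.

Definition convex_hull (R : realType) (A : set 'rV[R]_3) : set 'rV[R]_3 :=
  smallest (@convex_set R 'rV[R]_3) A.

Definition cell (R : realType) (v : hexa R) : set 'rV[R]_3 :=
  (convex_hull (range v))°.

Definition face (R : realType) (v : hexa R) (D : {set 'I_3}) (x : cube_vertex)
    : set 'rV[R]_3 :=
  convex_hull (v @` cube_face D x).

(* The polytope spanned by the eight points has nonempty interior (equivalently,
   positive volume), and each of the six quadruples of labels forming a facet of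
   the cube spans a facet: it lies in a plane that has the four other points
   strictly on one side.  The six facets then already form a closed surface, so
   there are no others; the edges and vertices of the polytope are their
   intersections, and its face lattice is that of the cube. *)
Definition is_hexahedron (R : realType) (v : hexa R) : Prop :=
  cell v !=set0 /\
  forall (d : 'I_3) (b : bool), exists (a : 'cV[R]_3) (c : R),
    forall x : cube_vertex,
      if x d == b then (v x *m a) 0 0 = c else (v x *m a) 0 0 < c.

(** * Meshes *)

Definition hexas (R : realType) (n : nat) : Type := 'I_n -> hexa R.

Definition conforming (R : realType) (v w : hexa R) : Prop :=
  closure (cell v) `&` closure (cell w) = set0 \/
  exists (D E : {set 'I_3}) (x y : cube_vertex),
    [/\ #|D| = #|E|, (#|D| <= 2)%N,
        closure (cell v) `&` closure (cell w) = face v D x &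
        closure (cell v) `&` closure (cell w) = face w E y].

(* The equation [(closure Omega)° = Omega] says that the domain is the interior of the union of the
   closed cells: without it, slits along faces between cells could be removed
   from [Omega] without changing its closure. *)
Definition hex_mesh (R : realType) (n : nat) (T : hexas R n)
    (Omega : set 'rV[R]_3) : Prop :=
  [/\ [/\ open Omega, bounded_set Omega, Omega !=set0, connected Omega &
          (closure Omega)° = Omega],
      forall i : 'I_n, is_hexahedron (T i),
      forall i j : 'I_n, i != j -> cell (T i) `&` cell (T j) = set0,
      forall i j : 'I_n, i != j -> conforming (T i) (T j) &
      \bigcup_(i in [set: 'I_n]) closure (cell (T i)) = closure Omega].

(** * Edge orientations *)

Definition edge_tail (R : realType) (v : hexa R) (d : 'I_3) (x : cube_vertex) :=
  v (setc x d false).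
Definition edge_head (R : realType) (v : hexa R) (d : 'I_3) (x : cube_vertex) :=
  v (setc x d true).

(* [o p q] means that the edge with end points [p] and [q] points from [p] to
   [q]; an edge is determined by its end points, so cells that contain it see
   the same direction. *)
Definition edge_orientation (R : realType) (n : nat) (T : hexas R n)
    (o : 'rV[R]_3 -> 'rV[R]_3 -> bool) : Prop :=
  forall (i : 'I_n) (d : 'I_3) (x : cube_vertex),
    o (edge_head (T i) d x) (edge_tail (T i) d x) =
    ~~ o (edge_tail (T i) d x) (edge_head (T i) d x).

(* The edges of the class [d] of the cell [i] are the edges from [edge_tail] to
   [edge_head] for varying [x]. *)
Definition consistent (R : realType) (n : nat) (T : hexas R n)
    (o : 'rV[R]_3 -> 'rV[R]_3 -> bool) : Prop :=
  forall (i : 'I_n) (d : 'I_3) (x y : cube_vertex),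
    o (edge_tail (T i) d x) (edge_head (T i) d x) =
    o (edge_tail (T i) d y) (edge_head (T i) d y).

Definition consistently_orientable (R : realType) (n : nat) (T : hexas R n)
    : Prop :=
  exists o : 'rV[R]_3 -> 'rV[R]_3 -> bool,
    edge_orientation T o /\ consistent T o.

(** * Closed strings of cells *)

(* The axis of the cube along which a string runs; the axes 0 and 1 span its
   cross section. *)
Definition string_axis : 'I_3 := ord_max.

(* Rotation by 90 degrees of the cross section. *)
Definition quarter_turn (x : cube_vertex) : cube_vertex :=
  [ffun e => if e == 0 then ~~ x 1 else if e == 1 then x 0 else x e].

(* The labels are carried along the string, so that consecutive cells are
   attached with equal cross section coordinates; attaching the ends after a
   twist by [k] times 90 degrees then identifies the free face of the last cell
   with the free face of the first one through [k] quarter turns.  Since the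
   labels may be left- or right-handed, so may be the twist.  Cells that do not
   follow each other in the string do not touch. *)
Definition closed_string (R : realType) (n : nat) (T : hexas R n) (k : nat)
    : Prop :=
  [/\ forall (i : 'I_n) (x : cube_vertex), (i.+1 < n)%N ->
        T i (setc x string_axis true) =
        T (ordS i) (setc x string_axis false),
      forall (i : 'I_n) (x : cube_vertex), i.+1 = n ->
        T i (setc x string_axis true) =
        T (ordS i) (setc (iter k quarter_turn x) string_axis false) &
      forall i j : 'I_n, i != j -> j != ordS i -> i != ordS j ->
        closure (cell (T i)) `&` closure (cell (T j)) = set0].

(** * Topology of the domain *)

Definition homeomorphic (U V : topologicalType) (A : set U) (B : set V) : Prop :=
  exists (f : U -> V) (g : V -> U),
    [/\ {within A, continuous f}, {within B, continuous g},
        forall x, A x -> B (f x) /\ g (f x) = x &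
        forall y, B y -> A (g y) /\ f (g y) = y].

(* The product of a circle and a closed disc. *)
Definition solid_torus (R : realType) : set ((R * R) * (R * R)) :=
  [set p | p.1.1 ^+ 2 + p.1.2 ^+ 2 = 1 /\ p.2.1 ^+ 2 + p.2.2 ^+ 2 <= 1].

Definition toroidal (R : realType) (Omega : set 'rV[R]_3) : Prop :=
  homeomorphic (closure Omega) (@solid_torus R).

Definition path_in (R : realType) (A : set 'rV[R]_3) (g : R -> 'rV[R]_3) : Prop :=
  {within `[0, 1], continuous g} /\ forall t, 0 <= t <= 1 -> A (g t).

Definition path_connected (R : realType) (A : set 'rV[R]_3) : Prop :=
  forall x y, A x -> A y -> exists g, [/\ path_in A g, g 0 = x & g 1 = y].

Definition null_homotopic (R : realType) (A : set 'rV[R]_3) (g : R -> 'rV[R]_3)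
    : Prop :=
  exists H : R * R -> 'rV[R]_3,
    [/\ {within `[0, 1] `*` `[0, 1], continuous H},
        forall s t, 0 <= s <= 1 -> 0 <= t <= 1 -> A (H (s, t)),
        forall t, 0 <= t <= 1 -> H (0, t) = g t,
        forall t, 0 <= t <= 1 -> H (1, t) = g 0 &
        forall s, 0 <= s <= 1 -> H (s, 0) = g 0 /\ H (s, 1) = g 0].

Definition simply_connected (R : realType) (A : set 'rV[R]_3) : Prop :=
  [/\ A !=set0, path_connected A &
      forall g, path_in A g -> g 0 = g 1 -> null_homotopic A g].

(* Neither a hole through the body formed by the closed cells (which might close
   up along an edge or a vertex only, and so be invisible in [Omega]) nor a
   cavity. *)
Definition without_holes (R : realType) (Omega : set 'rV[R]_3) : Prop :=
  simply_connected (closure Omega) /\ connected (~` Omega).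

(* Main.v *)
Require Import Defs.
From mathcomp Require Import all_boot all_order all_algebra.
From mathcomp Require Import all_classical all_reals all_analysis.
From mathcomp Require Import ring lra.
Import Order.TTheory GRing.Theory Num.Theory.
Import numFieldNormedType.Exports.

(** A consistent orientation amounts to one direction for each class of parallel
    edges of each cell, compatible along common edges.  It cannot exist if some
    chain of classes, each sharing an edge with the next, returns to its first
    class with the opposite direction.

    In a closed string the two classes of the cross section are carried
    unchanged from cell to cell and through [k] quarter turns at the attached
    ends, which gives such a chain for [k = 1, 2, 3].  For [k = 0] one lets all
    edges point in the direction of increasing labels; this is well defined
    because consecutive cells meet in the attached faces only.

    Strings with all four twists are tubes of quadrilateral section, mitred at
    the corners, around closed lattice polygons.  The section is carried along a
    side by projection in its direction, and for polygons that are not plane it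
    may return rotated.  A tube and the solid torus are images of the same cube
    under maps with the same fibres, hence homeomorphic.

    The 14 hexahedra form a body that is star-shaped with respect to the origin,
    a point of its interior, so all topological claims about it reduce to radial
    contractions.

    For the explicit cells everything follows from integer inequalities: a
    hexahedron is the intersection of the half-spaces of its facets, and two
    cells meet as required when a plane separates them and touches each of them
    exactly in the common face. *)

Set Implicit Arguments.
Unset Strict Implicit.
Unset Printing Implicit Defensive.
Local Open Scope classical_set_scope.
Local Open Scope ring_scope.

(** * Convexity and linear functionals *)

(** A tube around a plane polygon closes without a twist: the normal of the plane lies in every
    mitre plane and is fixed by the projections along the sides. Around a spatial polygon with sides
    along the coordinate axes, the section seen along a side is a square with sides along the axes,
    so it can return only after a whole number of quarter turns. A polygon with seven sides provides
    one quarter turn and one with eight sides provides two; exchanging the two axes of the section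
    turns one into three. All vertices are integer points, so that one computation settles an
    example over every [R]. An intersection of two hulls cannot be computed in this way; what is
    tested instead are the values of a candidate normal, taken from a short list, at the sixteen
    vertices. The numbering of the 14 cells carries information: each cell after number 0 shares a
    facet with an earlier one, which gives connectedness, and each facet with the origin strictly on
    its outer side has its vertices in an earlier cell, which gives star-shapedness. *)

Lemma continuous_bigsum (K : numFieldType) (W : normedModType K)
    (T : topologicalType) (I : Type) (r : seq I) (F : I -> T -> W) :
  (forall i, continuous (F i)) -> continuous (fun x => \sum_(i <- r) F i x).
Proof.
move=> cF; elim: r => [|i r IHr].
  rewrite (_ : (fun x => _) = fun=> 0); first exact: cst_continuous.
  by apply/funext => x; rewrite big_nil.
rewrite (_ : (fun x => _) = F i + (fun x => \sum_(j <- r) F j x)); last first.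
  by apply/funext => x; rewrite big_cons.
by move=> x; apply: continuousD; [exact: cF|exact: IHr].
Qed.

Section Convexity.
Variable R : realType.
Local Notation V := 'rV[R]_3.
Implicit Types (x y z : V) (a : 'cV[R]_3) (A B : set V) (c t : R).

Definition lf a x : R := (x *m a) 0 0.

Lemma lfD a x y : lf a (x + y) = lf a x + lf a y.
Proof. by rewrite /lf mulmxDl mxE. Qed.

Lemma lfZ a c x : lf a (c *: x) = c * lf a x.
Proof. by rewrite /lf -scalemxAl mxE. Qed.

Lemma lfN a x : lf a (- x) = - lf a x.
Proof. by rewrite -scaleN1r lfZ mulN1r. Qed.

Lemma lf_sum (I : finType) (P : pred I) (F : I -> V) a :
  lf a (\sum_(i | P i) F i) = \sum_(i | P i) lf a (F i).
Proof. by rewrite /lf mulmx_suml summxE. Qed.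

Lemma lfE a x : lf a x = x 0 0 * a 0 0 + x 0 1 * a 1 0 + x 0 ord_max * a ord_max 0.
Proof.
rewrite /lf mxE !big_ord_recl big_ord0 addr0 addrA.
by congr (_ * _ + _ * _ + _ * _); congr (fun_of_matrix _ _ _); apply/val_inj.
Qed.

Lemma lf_oppc a x : lf (- a) x = - lf a x.
Proof. by rewrite /lf mulmxN mxE. Qed.

Lemma lf_scalec a c x : lf (c *: a) x = c * lf a x.
Proof. by rewrite /lf -scalemxAr mxE. Qed.

Lemma lf_continuous a : continuous (lf a).
Proof.
rewrite (_ : lf a = fun x => x 0 0 * a 0 0 + x 0 1 * a 1 0 +
  x 0 ord_max * a ord_max 0); last by apply/funext => x; exact: lfE.
have cM i c : continuous (fun x : V => x 0 i * c).
  by move=> x; exact: (continuousM (@coord_continuous R 1 3 0 i x) (@cst_continuous V R c x)).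
by move=> x; exact: cvgD (cvgD (cM _ _ x) (cM _ _ x)) (cM _ _ x).
Qed.

(** [convex_set] takes its coefficients from an interval type; this is the form with plain
    inequalities in which convexity is used below. *)
Lemma convex_segment A : @convex_set R V A <->
  forall x y t, A x -> A y -> 0 <= t <= 1 -> A (t *: x + (1 - t) *: y).
Proof.
split=> [cA x y t Ax Ay t01|cA x y l /set_mem Ax /set_mem Ay].
  case/andP: t01 => t0 t1.
  have tP : Itv.spec (@Itv.num_sem R) (Itv.Real `[0%Z, 1%Z]) t.
    by rewrite /Itv.num_sem /= ?num_real in_itv /= t0 t1.
  have /set_mem := cA x y (Itv.mk tP) (mem_set Ax) (mem_set Ay).
  by [].
by apply/mem_set; apply: (cA _ _ l%:num) => //; rewrite ge0 le1.
Qed.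

Lemma convex_hull_convex A : @convex_set R V (convex_hull A).
Proof.
apply/convex_segment => x y t hx hy t01 B [/[dup] cB /convex_segment sB AB].
by apply: sB => //; [exact: hx|exact: hy].
Qed.

Lemma sub_convex_hull A : A `<=` convex_hull A.
Proof. exact: sub_gen_smallest. Qed.

Lemma convex_hull_min A B : @convex_set R V B -> A `<=` B -> convex_hull A `<=` B.
Proof. exact: smallest_sub. Qed.

Lemma convex_hullS A B : A `<=` B -> convex_hull A `<=` convex_hull B.
Proof.
move=> AB; apply: convex_hull_min; first exact: convex_hull_convex.
exact: subset_trans AB (@sub_convex_hull _).
Qed.

Lemma lf_segment a x y t :
  lf a (t *: x + (1 - t) *: y) = t * lf a x + (1 - t) * lf a y.
Proof. by rewrite lfD !lfZ. Qed.

Lemma convex_halfspace a c : @convex_set R V [set x | lf a x <= c].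
Proof.
apply/convex_segment => x y t /= xc yc /andP[t0 t1]; rewrite lf_segment; nra.
Qed.

Lemma convex_hull_le A a c : (forall x, A x -> lf a x <= c) ->
  forall x, convex_hull A x -> lf a x <= c.
Proof.
move=> Ac; have := @convex_hull_min A [set x | lf a x <= c].
by apply => //; exact: convex_halfspace.
Qed.

Lemma convex_hull_ge A a c : (forall x, A x -> c <= lf a x) ->
  forall x, convex_hull A x -> c <= lf a x.
Proof.
move=> Ac x hx; rewrite -lerN2 -lf_oppc; apply: convex_hull_le hx => y Ay.
by rewrite lf_oppc lerN2 Ac.
Qed.

(** The points strictly below the plane, together with the hull of the generators on it, form a
    convex set that contains [A]: a segment with one end strictly below stays strictly below, except
    perhaps at its other end. *)
Lemma convex_hull_supporting A a c :
  (forall x, A x -> lf a x <= c) ->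
  forall x, convex_hull A x -> lf a x = c ->
  convex_hull (A `&` [set y | lf a y = c]) x.
Proof.
move=> Ac; set F := _ `&` _.
have Fc : forall x, convex_hull F x -> lf a x <= c.
  by apply: convex_hull_le => x [/Ac].
have : convex_hull A `<=` [set x | lf a x < c \/ convex_hull F x].
  apply: convex_hull_min => [|x Ax]; last first.
    have [xc|] := ltP (lf a x) c; [by left|move=> cx; right].
    apply: sub_convex_hull; split=> //=; apply/eqP.
    by rewrite eq_le cx andbT; exact: Ac.
  apply/convex_segment => x y t Hx Hy /andP[]; rewrite !le_eqVlt.
  move=> /orP[/eqP<- _|t0]; first by rewrite scale0r subr0 scale1r add0r.
  move=> /orP[/eqP->|t1]; first by rewrite subrr scale0r scale1r addr0.
  have [lx|lx] := ltP (lf a x) c.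
    left; rewrite lf_segment; have := Fc y; case: Hy => [|hy /(_ hy)]; nra.
  case: Hx => [|hx]; first by rewrite ltNge lx.
  case: Hy => [|hy].
    by left; rewrite lf_segment; have := Fc x hx; nra.
  right; move/convex_segment: (@convex_hull_convex F); apply => //.
  by rewrite !ltW.
move=> H x /H[|//] /= + xc; by rewrite xc ltxx.
Qed.

Lemma interior_dir A x : A° x -> forall d : V,
  exists2 e : R, 0 < e & forall t, `|t| <= e -> A (x + t *: d).
Proof.
move=> /nbhs_ballP[r /= r0 rA] d.
have d1 : 0 < `|d| + 1 by rewrite ltr_wpDl.
exists (r / 2 / (`|d| + 1)) => [|t te]; first by rewrite !divr_gt0.
apply: rA; rewrite -ball_normE /= opprD addrA subrr sub0r normrN normrZ.
have : `|t| * `|d| <= r / 2.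
  apply: (@le_trans _ _ (`|t| * (`|d| + 1))).
    by rewrite ler_wpM2l // lerDl.
  by rewrite -ler_pdivlMr.
by move=> /le_lt_trans; apply; lra.
Qed.

Lemma lf_trmx_gt0 a : a != 0 -> 0 < lf a a^T.
Proof.
move=> a0; rewrite /lf mxE; under eq_bigr do rewrite mxE -expr2.
rewrite lt_neqAle sumr_ge0 ?andbT => [|i _]; last exact: sqr_ge0.
rewrite eq_sym psumr_eq0 => [|i _]; last exact: sqr_ge0.
apply: contraNN a0 => /allP a0; apply/eqP/matrixP => i j.
have /eqP := a0 i (mem_index_enum _).
by rewrite ord1 mxE => /eqP; rewrite sqrf_eq0 => /eqP.
Qed.

Lemma interior_lt A a c : a != 0 -> (forall x, A x -> lf a x <= c) ->
  forall x, A° x -> lf a x < c.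
Proof.
move=> a0 Ac x /interior_dir/(_ a^T)[e e0 eA].
have ee : `|e| <= e by rewrite ger0_norm // ltW.
have := Ac _ (eA e ee).
by rewrite lfD lfZ; apply: lt_le_trans; rewrite ltrDl mulr_gt0 // lf_trmx_gt0.
Qed.

(** The homothety with centre [x] and ratio [t] carries a ball around [p] to a ball whose radius is
    multiplied by [t]. *)
Lemma interior_homothety A p x t : A° p -> 0 < t ->
  (forall y, A y -> A (t *: y + (1 - t) *: x)) -> A° (t *: p + (1 - t) *: x).
Proof.
move=> /nbhs_ballP[s /= s0 sA] t0 cA; apply/nbhs_ballP.
exists (t * s) => [|y]; first exact: mulr_gt0.
rewrite -ball_normE /= => ys.
rewrite (_ : y = t *: (t^-1 *: (y - (1 - t) *: x)) + (1 - t) *: x); last first.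
  by rewrite scalerA divff ?gt_eqF // scale1r subrK.
apply/cA/sA; rewrite -ball_normE /=.
have -> : p - t^-1 *: (y - (1 - t) *: x) =
    t^-1 *: (t *: p + (1 - t) *: x - y).
  rewrite -addrA [in RHS]scalerDr scalerA mulVf ?gt_eqF // scale1r.
  by rewrite -scalerN opprB.
by rewrite normrZ gtr0_norm ?invr_gt0 // mulrC ltr_pdivrMr // mulrC.
Qed.

Lemma closure_interior_convex A : closed A -> @convex_set R V A ->
  A° !=set0 -> closure A° = A.
Proof.
move=> clA /convex_segment cA [p Ap]; apply/seteqP; split.
  apply: subset_trans (closureS (@interior_subset _ _)) _.
  by move/closure_id: clA => <-.
move=> x Ax B /nbhs_ballP[r /= r0 rB].
have D0 : 0 < `|p - x| + 1 by rewrite ltr_wpDl.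
(* With this choice the shift [t * |p - x|] is at most half the radius; the added 1 keeps the
   denominator positive even for [p = x]. *)
pose t := Num.min 1 (r / 2 / (`|p - x| + 1)).
have t0 : 0 < t by rewrite lt_min ltr01 !divr_gt0.
have t1 : t <= 1 by rewrite ge_min lexx.
exists (t *: p + (1 - t) *: x); split.
  by apply: interior_homothety => // y Ay; apply: cA; rewrite // t1 ltW.
apply: rB; rewrite -ball_normE /=.
have -> : x - (t *: p + (1 - t) *: x) = t *: (x - p).
  by rewrite scalerBl scale1r opprD opprB addrCA subrKC addrC -scalerBr.
rewrite normrZ gtr0_norm // distrC.
have : t * `|p - x| <= r / 2.
  apply: (@le_trans _ _ (t * (`|p - x| + 1))).
    by rewrite ler_wpM2l ?lerDl // ltW.
  by rewrite -ler_pdivlMr // ge_min lexx orbT.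
by move=> /le_lt_trans; apply; lra.
Qed.

(** The hull is the image of the standard simplex, which is closed and bounded, under the linear map
    with the given points as rows. *)
Lemma convex_hull_compact (I : finType) (v : I -> V) :
  compact (convex_hull (range v)).
Proof.
pose S : set 'rV[R]_#|I| := [set w | (forall i, 0 <= w 0 i) /\ \sum_i w 0 i = 1].
pose M : 'M[R]_(#|I|, 3) := \matrix_i v (enum_val i).
have wM w : w *m M = \sum_i w 0 i *: v (enum_val i).
  by rewrite mulmx_sum_row; apply: eq_bigr => i _; rewrite rowK.
have cS : compact S.
  apply: bounded_closed_compact.
    exists 1; split=> // M' M1 w [w0 w1].
    rewrite /Num.norm /= mx_normrE; apply/bigmax_leP; split => [|[i j] _ /=].
      by rewrite ltW // (lt_trans ltr01).
    rewrite ord1 ger0_norm // (le_trans _ (ltW M1)) // -w1.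
    rewrite (bigD1 j) //= lerDl; apply: sumr_ge0 => l _; exact: w0.
  rewrite (_ : S = (\bigcap_i [set w | 0 <= w 0 i]) `&`
      [set w | \sum_i w 0 i = 1]); last first.
    apply/seteqP; split=> w; first by case=> w0 w1; split => // i _; exact: w0.
    case=> w0 w1; split => // i. exact: w0.
  apply: closedI.
    apply: closed_bigI => i _; apply: (@preimage_closed _ _ (fun w : 'rV[R]__ => w 0 i) [set x | 0 <= x]).
      by move=> w _; exact: coord_continuous.
    exact: closed_ge.
  apply: (@preimage_closed _ _ (fun w : 'rV[R]_#|I| => \sum_i w 0 i) [set x | x = 1]).
    move=> w _; apply: continuous_bigsum => i {}w; exact: coord_continuous.
  exact: closed_eq.
have cM : continuous (fun w : 'rV[R]_#|I| => w *m M).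
  rewrite (_ : (fun w => _) =
      fun w : 'rV[R]_#|I| => \sum_i w 0 i *: v (enum_val i)); last first.
    by apply/funext.
  apply: continuous_bigsum => i w.
  apply: (@continuousZr_tmp _ _ _ (fun w : 'rV_#|I| => w 0 i)).
  exact: coord_continuous.
suff -> : convex_hull (range v) = (fun w => w *m M) @` S.
  apply: continuous_compact => //; exact: continuous_subspaceT.
apply/seteqP; split.
  apply: convex_hull_min.
    apply/convex_segment => _ _ t [w [w0 w1] <-] [u [u0 u1] <-] /andP[t0 t1].
    exists (t *: w + (1 - t) *: u); last by rewrite mulmxDl -!scalemxAl.
    split=> [i|]; first by rewrite !mxE addr_ge0 // mulr_ge0 // subr_ge0.
    under eq_bigr do rewrite !mxE.
    by rewrite big_split /= -!mulr_sumr w1 u1 !mulr1 addrC subrK.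
  move=> _ [i _ <-]; exists (delta_mx 0 (enum_rank i)).
    split=> [j|]; first by rewrite mxE ler0n.
    rewrite (bigD1 (enum_rank i)) //= mxE !eqxx big1 ?addr0 // => j ji.
    by rewrite mxE (negbTE ji) andbF.
  by rewrite -rowE rowK enum_rankK.
move=> _ [w [w0 w1] <-] B [/convex_segment cB vB]; rewrite wM.
(* Convexity combines two points only, so a combination is built up vertex by vertex, each partial
   sum being divided by its total weight. *)
suff H : forall r : seq 'I_#|I|, 0 < \sum_(i <- r) w 0 i ->
    B ((\sum_(i <- r) w 0 i)^-1 *: \sum_(i <- r) w 0 i *: v (enum_val i)).
  by have := H (index_enum _); rewrite w1 invr1 scale1r; apply.
elim=> [|i r IHr]; first by rewrite big_nil ltxx.
rewrite !big_cons; set s := \sum_(j <- r) w 0 j in IHr *.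
set y := \sum_(j <- r) _ in IHr * => is0.
have s0 : 0 <= s by apply: sumr_ge0.
have Bi : B (v (enum_val i)) by apply: vB; exists (enum_val i).
have [sE|sN] := eqVneq s 0.
  have -> : y = 0.
    move/eqP: sE; rewrite psumr_eq0 // => /allP sE.
    rewrite /y big_seq big1 // => j /sE /eqP ->; exact: scale0r.
  move: is0; rewrite sE !addr0 => wi0.
  by rewrite scalerA mulVf ?scale1r // gt_eqF.
have {}s0 : 0 < s by rewrite lt_neqAle eq_sym sN.
have := cB _ _ (w 0 i / (w 0 i + s)) Bi (IHr s0).
rewrite divr_ge0 ?ler_pdivrMr ?mul1r ?lerDl ?(ltW s0) ?(ltW is0) // => /(_ isT).
congr (B _); rewrite [in RHS]scalerDr !scalerA; congr (_ *: _ + _ *: _).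
  by rewrite mulrC.
by field; rewrite !gt_eqF.
Qed.

End Convexity.

(** * Hexahedra as intersections of half-spaces *)

Section Hexahedra.
Variable R : realType.
Local Notation V := 'rV[R]_3.
Implicit Types (x : cube_vertex) (v w : hexa R) (a l : 'cV[R]_3).

Lemma setc_same x d b : setc x d b d = b.
Proof. by rewrite ffunE eqxx. Qed.

Lemma setc_neq x d b e : e != d -> setc x d b e = x e.
Proof. by rewrite ffunE => /negbTE ->. Qed.

Lemma setc_id x d : setc x d (x d) = x.
Proof. by apply/ffunP => e; rewrite ffunE; case: eqP => // ->. Qed.

(** The point [p] of [K] nearest to [z] gives the functional [(z - p)^T]: if some [y] in [K] were on
    the wrong side, a short move from [p] towards [y] would come closer to [z]. *)
Lemma compact_convex_separation (K : set V) (z : V) :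
  compact K -> @convex_set R V K -> ~ K z ->
  exists l, forall y, K y -> lf l y < lf l z.
Proof.
move=> cK /convex_segment xK Kz.
have [K0|/nonemptyPn K0] := pselect (K !=set0); last first.
  by exists 0 => y; rewrite K0.
(* The norm of row vectors is the maximum norm, so the squared Euclidean distance is spelled out. *)
pose q (y : V) := \sum_i (y 0 i - z 0 i) ^+ 2.
have qE y : q y = lf (y - z)^T (y - z).
  rewrite /q /lf mxE; apply: eq_bigr => i _; by rewrite !mxE expr2.
have cq : continuous q.
  apply: continuous_bigsum => i y.
  have cd : {for y, continuous (fun y : V => y 0 i - z 0 i)}.
    by apply: (@continuousB _ _ _ (fun y : V => y 0 i)); [exact: coord_continuous|exact: cst_continuous].
  exact: (continuousM cd cd).
have [p /set_mem Kp pmin] := EVT_min_rV K0 cK (continuous_subspaceT cq).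
pose u := p - z.
have u0 : u != 0.
  by apply/eqP => /eqP; rewrite subr_eq0 => /eqP pz; apply: Kz; rewrite -pz.
have uu : 0 < lf u^T u.
  by have := @lf_trmx_gt0 _ u^T; rewrite trmxK; apply; rewrite trmx_eq0.
exists (- u^T) => y Ky; rewrite !lf_oppc ltrN2.
have zE : z = p - u by rewrite /u opprB addrC subrK.
suff : 0 <= lf u^T (y - p).
  by rewrite lfD lfN subr_ge0; apply: lt_le_trans; rewrite {1}zE lfD lfN gtrBl.
rewrite leNgt; apply/negP => s0; set s := lf _ _ in s0.
pose n := lf (y - p)^T (y - p).
have n0 : 0 <= n.
  by rewrite /n /lf mxE; apply: sumr_ge0 => i _; rewrite !mxE -expr2 sqr_ge0.
(* Small enough for the quadratic term [t ^+ 2 * n] to stay below [- t * s], so that the negative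
   linear term [t * s *+ 2] prevails. *)
pose t := Num.min 1 (- s / (n + 1)).
have t0 : 0 < t by rewrite lt_min ltr01 divr_gt0 // ?oppr_gt0 // ltr_wpDl.
have t1 : t <= 1 by rewrite ge_min lexx.
have tn : t * (n + 1) <= - s.
  by rewrite -ler_pdivlMr ?ltr_wpDl // ge_min lexx orbT.
have := pmin (t *: y + (1 - t) *: p).
rewrite inE => /(_ (xK _ _ _ Ky Kp _)); rewrite t1 (ltW t0) => /(_ isT).
rewrite !qE -/u.
have -> : t *: y + (1 - t) *: p - z = u + t *: (y - p).
  by apply/rowP => i; rewrite !mxE; ring.
have -> : lf (u + t *: (y - p))^T (u + t *: (y - p)) =
    lf u^T u + t * s *+ 2 + t ^+ 2 * n.
  have lfDc l1 l2 (x : V) : lf (l1 + l2) x = lf l1 x + lf l2 x.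
    by rewrite /lf mulmxDr mxE.
  rewrite (_ : _^T = u^T + t *: (y - p)^T); last by rewrite linearD linearZ.
  rewrite lfDc lf_scalec !(lfD _ u) !(lfZ _ t) -/s -/n.
  have -> : lf (y - p)^T u = s.
    by rewrite /s /lf !mxE; apply: eq_bigr => i _; rewrite !mxE; ring.
  ring.
nra.
Qed.

Definition facet_plane v (d : 'I_3) (b : bool) a c : Prop :=
  forall x, if x d == b then lf a (v x) = c else lf a (v x) < c.

Lemma facet_plane_le v d b a c x : facet_plane v d b a c -> lf a (v x) <= c.
Proof. by move=> /(_ x); case: ifP => _; [move=> ->|move/ltW]. Qed.

Lemma hexahedron_planes v : is_hexahedron v ->
  exists (a : 'I_3 -> bool -> 'cV[R]_3) (c : 'I_3 -> bool -> R),
    forall d b, facet_plane v d b (a d b) (c d b).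
Proof.
move=> [_ H].
have /choice[f fP] : forall p : 'I_3 * bool, exists q : 'cV[R]_3 * R,
    facet_plane v p.1 p.2 q.1 q.2.
  by move=> [d b]; have [a [c ac]] := H d b; exists (a, c).
exists (fun d b => (f (d, b)).1), (fun d b => (f (d, b)).2) => d b.
exact: (fP (d, b)).
Qed.

(* At a vertex of [v] the three edges are, up to scaling, dual to the three
   facets, so a functional that is maximal at the vertex is maximal on the
   intersection of the half-spaces. *)
Lemma hexahedron_halfspaces v (a : 'I_3 -> bool -> 'cV[R]_3) c :
  (forall d b, facet_plane v d b (a d b) (c d b)) ->
  convex_hull (range v) = [set y | forall d b, lf (a d b) y <= c d b].
Proof.
move=> f; apply/seteqP; split=> [y hy d b|y Hy].
  apply: convex_hull_le hy => _ [x _ <-]; exact: facet_plane_le (f d b).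
apply: contrapT => /compact_convex_separation.
move=> /(_ (@convex_hull_compact _ _ v) (@convex_hull_convex _ _))[l lP].
have [x _ xmax] : exists2 x, true & forall x', lf l (v x') <= lf l (v x).
  have := @Order.TotalTheory.arg_maxP _ R cube_vertex [ffun=> false] xpredT
    (fun x => lf l (v x)) isT.
  by case=> x _ xP; exists x => // x'; exact: xP.
have nbb b : (~~ b == b) = false by case: b.
pose nb d := v (setc x d (~~ x d)).
pose dl d := lf (a d (x d)) (nb d - v x).
have dl0 d : dl d < 0.
  rewrite /dl lfD lfN subr_lt0.
  have := f d (x d) x; rewrite eqxx => ->.
  have := f d (x d) (setc x d (~~ x d)).
  by rewrite setc_same nbb.
(* The columns of [A] are the normals of the three facets at the vertex, the rows of [E] the three
   edges leaving it. Each edge lies in all these facets but one, so [E *m A] is diagonal with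
   negative entries. *)
pose A := \matrix_(i, j) a j (x j) i 0.
pose E := \matrix_(i, j) (nb i - v x) 0 j.
have lfA (z : V) d : (z *m A) 0 d = lf (a d (x d)) z.
  by rewrite /lf !mxE; apply: eq_bigr => i _; rewrite !mxE.
have EA : E *m A = diag_mx (\row_d dl d).
  apply/matrixP => d e; rewrite !mxE.
  transitivity (lf (a e (x e)) (nb d - v x)).
    by rewrite /lf mxE; apply: eq_bigr => i _; rewrite !mxE.
  case: eqP => [->|/eqP de]; rewrite ?mulr1n ?mulr0n //.
  rewrite lfD lfN; have := f e (x e) x; rewrite eqxx => ->.
  have := f e (x e) (setc x d (~~ x d)).
  by rewrite setc_neq 1?eq_sym // eqxx /nb => ->; rewrite subrr.
have Au : A \in unitmx.
  have : E *m A \in unitmx.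
    rewrite EA unitmxE det_diag unitfE; apply/prodf_neq0 => d _.
    by rewrite mxE lt_eqF.
  by rewrite unitmx_mul => /andP[].
(* The coordinates of [y - v x] in the basis of edges. They are nonnegative, being quotients of a
   nonpositive by a negative number. *)
pose k : V := \row_d (lf (a d (x d)) (y - v x) / dl d).
have yE : y - v x = k *m E.
  apply/eqP; rewrite -subr_eq0; apply/eqP.
  rewrite -[LHS](mulmxK Au) [X in X *m _](_ : _ = 0) ?mul0mx //.
  apply/rowP => d; rewrite mulmxBl -mulmxA EA mul_mx_diag.
  transitivity (((y - v x) *m A) 0 d - k 0 d * dl d).
    by rewrite !mxE.
  by rewrite lfA mxE mulfVK ?subrr ?mxE // lt_eqF.
have := lP (v x) (sub_convex_hull (ex_intro2 _ _ x I erefl)).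
rewrite -subr_gt0 -lfN -lfD yE mulmx_sum_row lf_sum ltNge => /negP; apply.
apply: sumr_le0 => d _; rewrite lfZ.
have -> : row d E = nb d - v x by apply/rowP => j; rewrite !mxE.
have kd : 0 <= k 0 d.
  rewrite mxE ler_ndivlMr // mul0r lfD lfN subr_le0.
  by have := f d (x d) x; rewrite eqxx => ->; exact: Hy.
by rewrite mulr_ge0_le0 // lfD lfN subr_le0 xmax.
Qed.

Lemma near_halfspaces (I : finType) (P : pred I) (a : I -> 'cV[R]_3) (c : I -> R)
    (y : V) : (forall i, P i -> lf (a i) y < c i) ->
  nbhs y [set z | forall i, P i -> lf (a i) z < c i].
Proof.
move=> yc.
apply: (@filter_forall _ _ (fun i z => P i -> lf (a i) z < c i) (nbhs y)) => i.
have [Pi|_] := boolP (P i); last exact: nearW.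
apply: filterS (_ : nbhs y (lf (a i) @^-1` [set x | x < c i])); first by [].
by apply: lf_continuous; apply: open_nbhs_nbhs; split; [exact: open_lt|exact: yc].
Qed.

Lemma hexahedron_interior v (a : 'I_3 -> bool -> 'cV[R]_3) c (y : V) :
  (forall d b, facet_plane v d b (a d b) (c d b)) ->
  (forall d b, lf (a d b) y < c d b) -> cell v y.
Proof.
move=> f yc; rewrite /cell (hexahedron_halfspaces f).
have : forall p : 'I_3 * bool, predT p -> lf (a p.1 p.2) y < c p.1 p.2 by [].
move=> /near_halfspaces; apply: filterS => z zP d b; apply/ltW.
exact: (zP (d, b)).
Qed.

(** Source of relative interior points: over all vertices it gives a point of the open cell, over a
    facet a point strictly inside all other half-spaces. *)
Definition vertex_mean v (P : pred cube_vertex) : V :=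
  #|P|%:R^-1 *: \sum_(x in P) v x.

Lemma vertex_mean_eq v (P : pred cube_vertex) a c x : x \in P ->
  (forall x, x \in P -> lf a (v x) = c) -> lf a (vertex_mean v P) = c.
Proof.
move=> Px Pc; rewrite /vertex_mean lfZ lf_sum (eq_bigr (fun=> c)) // sumr_const.
rewrite -[c *+ _]mulr_natl mulKf // pnatr_eq0 -lt0n; apply/card_gt0P; by exists x.
Qed.

Lemma vertex_mean_lt v (P : pred cube_vertex) a c x : x \in P ->
  lf a (v x) < c -> (forall x, x \in P -> lf a (v x) <= c) ->
  lf a (vertex_mean v P) < c.
Proof.
move=> Px xc Pc; rewrite /vertex_mean lfZ lf_sum mulrC ltr_pdivrMr.
  rewrite mulr_natr -sumr_const (bigD1 x) //= [ltRHS](bigD1 x) //=.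
  by apply: ltr_leD => //; apply: ler_sum => i /andP[/Pc].
by rewrite ltr0n; apply/card_gt0P; exists x.
Qed.

Lemma is_hexahedron_planes v (a : 'I_3 -> bool -> 'cV[R]_3) c :
  (forall d b, facet_plane v d b (a d b) (c d b)) -> is_hexahedron v.
Proof.
move=> f; split; last by move=> d b; exists (a d b), (c d b); exact: f.
exists (vertex_mean v predT); apply: (hexahedron_interior f) => d b.
apply: (@vertex_mean_lt _ _ _ _ [ffun=> ~~ b]) => //.
  by have := f d b [ffun=> ~~ b]; rewrite ffunE; case: (b).
by move=> x _; exact: facet_plane_le (f d b).
Qed.

Section Hexahedron.
Variables (v : hexa R) (hv : is_hexahedron v).

Lemma hexahedron_closed : closed (convex_hull (range v)).
Proof. by apply: compact_closed; [exact: norm_hausdorff|exact: convex_hull_compact]. Qed.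

Lemma closure_cell : closure (cell v) = convex_hull (range v).
Proof.
apply: closure_interior_convex; [exact: hexahedron_closed| |by case: hv].
exact: convex_hull_convex.
Qed.

Lemma vertex_hull x : convex_hull (range v) (v x).
Proof. by apply: sub_convex_hull; exists x. Qed.

(** For each axis outside [D] the whole face lies in one facet plane, and a vertex in that plane has
    the same label along this axis. *)
Lemma vertex_face D x y : face v D x (v y) -> cube_face D x y.
Proof.
move=> vy d dD; apply/eqP; apply: contraT => xy.
have [a [c f]] := hv.2 d (x d).
have : lf a (v y) = c.
  apply/eqP; rewrite eq_le.
  have fc z : (v @` cube_face D x) z -> lf a z = c.
    by move=> [x' /(_ d dD) x'd <-]; have := f x'; rewrite x'd eqxx.
  apply/andP; split.
    by apply: convex_hull_le vy => z /fc ->.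
  by apply: convex_hull_ge vy => z /fc ->.
by move=> yc; have := f y; rewrite (negbTE xy) -/(lf a (v y)) yc ltxx.
Qed.

Lemma hexahedron_inj : injective v.
Proof.
move=> x y xy; apply/ffunP => d.
have : face v finset.set0 y (v x) by rewrite xy; apply: sub_convex_hull; exists y.
by move=> /vertex_face/(_ d); apply; rewrite inE.
Qed.

End Hexahedron.

(** A facet determines its plane equation only up to a positive factor. Replacing one equation makes
    those of two cells at a shared facet literally opposite. *)
Definition override_plane (T : Type) (g : 'I_3 -> bool -> T) d b t d' b' :=
  if (d' == d) && (b' == b) then t else g d' b'.

Lemma hexahedron_planes_with v d b l c0 : is_hexahedron v ->
  facet_plane v d b l c0 ->
  exists (a : 'I_3 -> bool -> 'cV[R]_3) (c : 'I_3 -> bool -> R),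
    [/\ forall d b, facet_plane v d b (a d b) (c d b), a d b = l & c d b = c0].
Proof.
move=> /hexahedron_planes[a [c f]] lf0.
exists (override_plane a d b l), (override_plane c d b c0).
rewrite /override_plane !eqxx; split=> // d' b'.
by case: ifP => // /andP[/eqP-> /eqP->].
Qed.

Lemma facet_vertex_lt v (a : 'I_3 -> bool -> 'cV[R]_3) c (d : 'I_3) (b : bool)
    (d' : 'I_3) (b' : bool) :
  (forall d b, facet_plane v d b (a d b) (c d b)) ->
  (d', b') != (d, b) -> exists2 x : cube_vertex, x d = b & lf (a d' b') (v x) < c d' b'.
Proof.
move=> f db; exists (setc [ffun=> ~~ b'] d b); first by rewrite setc_same.
have := f d' b' (setc [ffun=> ~~ b'] d b).
have [dd|dd] := eqVneq d' d; last by rewrite setc_neq // ffunE; case: (b').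
move: db; rewrite dd xpair_eqE eqxx /= setc_same eq_sym.
by move=> /negbTE ->.
Qed.

(** Near [o] all strict inequalities persist, and each nearby point lies on one side of the shared
    plane, hence in one of the two cells. *)
Lemma facet_point_interior v w (a a' : 'I_3 -> bool -> 'cV[R]_3)
    (c c' : 'I_3 -> bool -> R) (d e : 'I_3) (b b' : bool) (o : V) :
  (forall d b, facet_plane v d b (a d b) (c d b)) ->
  (forall d b, facet_plane w d b (a' d b) (c' d b)) ->
  a' e b' = - a d b -> c' e b' = - c d b -> lf (a d b) o = c d b ->
  (forall d1 b1, (d1, b1) != (d, b) -> lf (a d1 b1) o < c d1 b1) ->
  (forall d1 b1, (d1, b1) != (e, b') -> lf (a' d1 b1) o < c' d1 b1) ->
  [/\ convex_hull (range v) o, convex_hull (range w) o &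
    (convex_hull (range v) `|` convex_hull (range w))° o].
Proof.
move=> fa fa' al cc ol oa oa'.
rewrite (hexahedron_halfspaces fa) (hexahedron_halfspaces fa'); split.
- move=> d1 b1; have [[-> ->]|/oa/ltW//] := eqVneq (d1, b1) (d, b).
  by rewrite ol.
- move=> d1 b1; have [[-> ->]|/oa'/ltW//] := eqVneq (d1, b1) (e, b').
  by rewrite al cc lf_oppc ol.
have n1 : nbhs o [set z | forall p : 'I_3 * bool, p != (d, b) ->
    lf (a p.1 p.2) z < c p.1 p.2].
  by apply: near_halfspaces => -[d1 b1]; exact: oa.
have n2 : nbhs o [set z | forall p : 'I_3 * bool, p != (e, b') ->
    lf (a' p.1 p.2) z < c' p.1 p.2].
  by apply: near_halfspaces => -[d1 b1]; exact: oa'.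
apply: filterS2 n1 n2 => z z1 z2.
have [zc|zc] := leP (lf (a d b) z) (c d b); [left|right] => d1 b1.
  have [[-> ->]//|db] := eqVneq (d1, b1) (d, b).
  exact: ltW (z1 _ db).
have [[-> ->]|db] := eqVneq (d1, b1) (e, b').
  by rewrite al cc lf_oppc lerN2 ltW.
exact: ltW (z2 _ db).
Qed.

(** The mean of the four common vertices lies strictly inside the other half-spaces of both cells.
    Such a point joins the two open cells within the interior of the body. *)
Lemma shared_facet_interior v w d b e b' l c0 :
  is_hexahedron v -> is_hexahedron w ->
  facet_plane v d b l c0 -> facet_plane w e b' (- l) (- c0) ->
  v @` [set x : cube_vertex | x d = b] = w @` [set x : cube_vertex | x e = b'] ->
  exists o, [/\ convex_hull (range v) o, convex_hull (range w) o &
    (convex_hull (range v) `|` convex_hull (range w))° o].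
Proof.
move=> hv hw fv fw vw.
have [a [c [fa al cc]]] := hexahedron_planes_with hv fv.
have [a' [c' [fa' al' cc']]] := hexahedron_planes_with hw fw.
pose P : pred cube_vertex := fun x => x d == b.
have xP : setc [ffun=> b] d b \in P by rewrite /P unfold_in setc_same.
pose o := vertex_mean v P.
have oa d1 b1 : (d1, b1) != (d, b) -> lf (a d1 b1) o < c d1 b1.
  move=> db; have [x xd xc] := facet_vertex_lt fa db.
  apply: (@vertex_mean_lt _ _ _ _ x) => //; first by rewrite unfold_in /P xd.
  by move=> y _; exact: facet_plane_le (fa _ _).
have oa' d1 b1 : (d1, b1) != (e, b') -> lf (a' d1 b1) o < c' d1 b1.
  move=> db; have [x xd xc] := facet_vertex_lt fa' db.
  have [y yd yx] : (v @` [set x : cube_vertex | x d = b]) (w x) by rewrite vw; exists x.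
  apply: (@vertex_mean_lt _ _ _ _ y); [by rewrite unfold_in /P yd|by rewrite yx|].
  move=> z /eqP zd; have : (v @` [set x : cube_vertex | x d = b]) (v z) by exists z.
  by rewrite vw => -[z' _ <-]; exact: facet_plane_le (fa' _ _).
have ol : lf l o = c0.
  apply: (@vertex_mean_eq _ _ _ _ _ xP) => x /eqP xd.
  by have := fv x; rewrite xd eqxx.
exists o; apply: (facet_point_interior fa fa' _ _ _ oa oa').
- by rewrite al' al.
- by rewrite cc' cc.
- by rewrite al cc.
Qed.

End Hexahedra.

(** * Star-shaped sets *)

Section StarShaped.
Variable R : realType.
Local Notation V := 'rV[R]_3.
Implicit Types (A B : set V) (p x y : V) (r s t : R).

Definition star_shaped p A : Prop :=
  A p /\ forall x t, A x -> 0 <= t <= 1 -> A (t *: x + (1 - t) *: p).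

Lemma convex_star_shaped A p : @convex_set R V A -> A p -> star_shaped p A.
Proof. by move=> /convex_segment cA Ap; split=> // x t Ax; exact: cA. Qed.

Lemma interior_star_shaped A p : A° p -> star_shaped p A -> star_shaped p A°.
Proof.
move=> Ap [_ sA]; split=> // x t Ax /andP[]; rewrite le_eqVlt.
move=> /orP[/eqP<-|t0] t1; first by rewrite scale0r subr0 scale1r add0r.
by apply: interior_homothety => // y Ay; apply: sA; rewrite // ltW.
Qed.

Lemma segment_path_continuous p x : continuous (fun t => t *: x + (1 - t) *: p).
Proof.
move=> t; apply: (@continuousD _ _ _ (fun t : R => t *: x)).
  by apply: (@continuousZr_tmp _ _ _ id); exact: cvg_id.
apply: (@continuousZr_tmp _ _ _ (fun t => 1 - t)).
by apply: cvgB; [exact: cvg_cst|exact: cvg_id].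
Qed.

Lemma star_shaped_connected A p : star_shaped p A -> connected A.
Proof.
move=> [Ap sA].
have -> : A = \bigcup_(x in A) ((fun t => t *: x + (1 - t) *: p) @` `[0, 1]).
  apply/seteqP; split=> [x Ax|_ [x Ax [t + <-]]]; last first.
    by rewrite /= in_itv /=; exact: sA.
  exists x => //; exists 1; first by rewrite /= in_itv /= ler01 lexx.
  by rewrite subrr scale0r addr0 scale1r.
apply: bigcup_connected => [|x Ax].
  exists p => x Ax; exists 0; first by rewrite /= in_itv /= ler01 lexx.
  by rewrite subr0 scale1r scale0r add0r.
apply: connected_continuous_connected; first exact: segment_connected.
exact/continuous_subspaceT/segment_path_continuous.
Qed.

Lemma connected_between (T : topologicalType) (A B : set T) :
  connected A -> A `<=` B -> B `<=` closure A -> connected B.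
Proof.
move=> cA AB BA U [z Uz] [C1 oC1 UC1] [C2 cC2 UC2].
move: (Uz); rewrite UC1 => -[Bz C1z].
have [y [Ay C1y]] := BA z Bz C1 (open_nbhs_nbhs (conj oC1 C1z)).
have AC : A `&` C1 = A `&` C2.
  by rewrite -[A](setIidl AB) -!setIA -UC1 -UC2.
have : A `&` C1 = A.
  by apply: cA; [exists y|exists C1|exists C2].
rewrite AC => AC2; rewrite -UC1 UC2; apply/setIidl.
apply: subset_trans BA _; move/closure_id: cC2 => ->; apply: closureS.
by rewrite -AC2; exact: subIsetr.
Qed.

(** Retraction of the line onto the unit interval. Composed with it, paths become continuous on the
    whole line and no subspace topology has to be carried along. *)
Definition clamp t : R := Num.min 1 (Num.max 0 t).

Lemma clamp_continuous : continuous clamp.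
Proof.
move=> t; apply: (@continuous_min _ _ (fun=> 1)); first exact: cst_continuous.
by apply: (@continuous_max _ _ (fun=> 0)); [exact: cst_continuous|exact: cvg_id].
Qed.

Lemma clamp_itv t : 0 <= clamp t <= 1.
Proof. by rewrite /clamp le_min ge_min !le_max ler01 !lexx. Qed.

Lemma clamp_id t : 0 <= t <= 1 -> clamp t = t.
Proof. by move=> /andP[t0 t1]; rewrite /clamp max_r // min_r. Qed.

Lemma clamp_le0 t : t <= 0 -> clamp t = 0.
Proof. by move=> t0; rewrite /clamp max_l // min_r. Qed.

Lemma clamp_ge1 t : 1 <= t -> clamp t = 1.
Proof. by move=> t1; rewrite /clamp max_r ?min_l // (le_trans ler01). Qed.

Lemma continuous_clamp (T : topologicalType) (g : R -> T) :
  {within `[0, 1], continuous g} -> continuous (g \o clamp).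
Proof.
move=> /subspace_continuousP cg t.
have tI : `[0, 1]%classic (clamp t) by rewrite /= in_itv /= clamp_itv.
apply: cvg_trans (cg _ tI) => P; rewrite /within /= => gP.
have cP : nbhs t [set u | `[0, 1]%classic (clamp u) -> P (g (clamp u))] :=
  clamp_continuous gP.
by apply: (filterS _ cP) => u /=; apply; rewrite in_itv /= clamp_itv.
Qed.

(* The loop is first pulled through the centre around the middle of the unit
   interval; the remaining path runs to the centre and back, and is contracted
   to the base point. *)
Lemma star_shaped_null_homotopic A p g : star_shaped p A ->
  path_in A g -> g 0 = g 1 -> null_homotopic A g.
Proof.
move=> [Ap sA] [cg Ag] g01.
(* [l1] falls from 1 to 0 on the first third, vanishes on the middle third and climbs back to 1;
   [t1] runs through the loop during the middle third only. [u] is active for homotopy times up to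
   1/2, [w] afterwards. *)
pose l1 t : R := Num.max 0 (Num.max (1 - 3 * t) (3 * t - 2)).
pose t1 t : R := clamp (3 * t - 1).
pose u (q : R * R) := clamp (2 * q.1).
pose w (q : R * R) := clamp (2 * q.1 - 1).
pose l q := 1 - u q + u q * l1 q.2.
pose ta q := (1 - u q) * q.2 + u q * t1 q.2.
exists (fun q => p + l q *: (g (clamp (ta q)) - p) +
  (w q * (1 - l1 q.2)) *: (g 0 - p)).
have l1I t : 0 <= t <= 1 -> 0 <= l1 t <= 1.
  move=> /andP[t0 t1']; rewrite /l1 le_max lexx /= !ge_max ler01 /=.
  by apply/andP; split; lra.
have l10 : l1 0 = 1.
  by rewrite /l1 mulr0 subr0 add0r [Num.max 1 _]max_l ?max_r //; lra.
have l11 : l1 1 = 1.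
  by rewrite /l1 mulr1 [Num.max (1 - 3) _]max_r ?max_r; lra.
have t1I t : 0 <= t1 t <= 1 by exact: clamp_itv.
have in01 (z : V) (a : R) : 0 <= a <= 1 -> A z -> A (p + a *: (z - p)).
  move=> aI /sA/(_ aI); congr (A _).
  by apply/rowP => i; rewrite !mxE; ring.
(* Wherever [l1] is nonzero, [t1] is 0 or 1, so the loop stands at its base point. *)
have second t : 0 <= t <= 1 ->
    l1 t *: (g (t1 t) - p) = l1 t *: (g 0 - p).
  move=> tI; have [->|l0] := eqVneq (l1 t) 0; first by rewrite !scale0r.
  have [t3|t3] := leP (3 * t) 1.
    by rewrite /t1 clamp_le0 // subr_le0.
  have [t2|t2] := leP 2 (3 * t).
    by rewrite /t1 clamp_ge1 ?g01 //; lra.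
  move: l0; rewrite /l1 max_l ?eqxx // ge_max; apply/andP; split; lra.
split.
- apply: continuous_subspaceT.
  have cu : continuous u.
    by move=> q; apply: (@continuous_comp _ _ _ (fun q : R * R => 2 * q.1));
      [apply: cvgM; [exact: cvg_cst|exact: cvg_fst]|exact: clamp_continuous].
  have cw : continuous w.
    move=> q; apply: (@continuous_comp _ _ _ (fun q : R * R => 2 * q.1 - 1));
      last exact: clamp_continuous.
    apply: cvgB; [|exact: cvg_cst].
    by apply: cvgM; [exact: cvg_cst|exact: cvg_fst].
  have ct1 : continuous (fun q : R * R => t1 q.2).
    move=> q; apply: (@continuous_comp _ _ _ (fun q : R * R => 3 * q.2 - 1));
      last exact: clamp_continuous.
    apply: cvgB; [|exact: cvg_cst].
    by apply: cvgM; [exact: cvg_cst|exact: cvg_snd].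
  have cl1 : continuous (fun q : R * R => l1 q.2).
    move=> q; apply: (@continuous_max R _ (fun=> 0)
      (fun q : R * R => Num.max (1 - 3 * q.2) (3 * q.2 - 2)) q).
      exact: cst_continuous.
    apply: (@continuous_max R _ (fun q : R * R => 1 - 3 * q.2)
      (fun q : R * R => 3 * q.2 - 2) q).
      apply: cvgB; first exact: cvg_cst.
      by apply: cvgM; [exact: cvg_cst|exact: cvg_snd].
    apply: cvgB; [|exact: cvg_cst].
    by apply: cvgM; [exact: cvg_cst|exact: cvg_snd].
  have cl : continuous l.
    move=> q; apply: cvgD; last by apply: cvgM; [exact: cu|exact: cl1].
    by apply: cvgB; [exact: cvg_cst|exact: cu].
  have cta : continuous ta.
    move=> q; apply: cvgD; last by apply: cvgM; [exact: cu|exact: ct1].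
    by apply: cvgM; [apply: cvgB; [exact: cvg_cst|exact: cu]|exact: cvg_snd].
  have cgt : continuous (fun q => g (clamp (ta q))).
    move=> q; apply: (@continuous_comp _ _ _ ta (g \o clamp)); first exact: cta.
    exact: continuous_clamp.
  move=> q; apply: (@continuousD _ _ _ (fun q => p + l q *: (g (clamp (ta q)) - p))).
    apply: (@continuousD _ _ _ (fun=> p)); first exact: cst_continuous.
    apply: (@continuousZ _ _ _ l); first exact: cl.
    apply: (@continuousB _ _ _ (fun q => g (clamp (ta q)))); first exact: cgt.
    exact: cst_continuous.
  apply: (@continuousZr_tmp _ _ _ (fun q => w q * (1 - l1 q.2))).
  by apply: cvgM; [exact: cw|apply: cvgB; [exact: cvg_cst|exact: cl1]].
- move=> s t sI tI; have /andP[l10' l11'] := l1I t tI; have /andP[t10 t11] := t1I t.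
  have [s2|s2] := leP (2 * s) 1.
    have -> : w (s, t) = 0 by rewrite /w clamp_le0 // subr_le0.
    rewrite mul0r scale0r addr0.
    have uI : 0 <= u (s, t) <= 1 by exact: clamp_itv.
    apply: in01; last by apply: Ag; exact: clamp_itv.
    by rewrite /l /=; case/andP: uI => u0 u1; apply/andP; split; nra.
  have u1 : u (s, t) = 1 by rewrite /u clamp_ge1 // ltW.
  rewrite /l /ta u1 /= subrr !mul0r !add0r !mul1r clamp_id // second // -addrA -scalerDl.
  have /andP[w0 w1] : 0 <= w (s, t) <= 1 by exact: clamp_itv.
  apply: in01; last by apply: Ag; rewrite lexx ler01.
  rewrite addr_ge0 ?mulr_ge0 ?subr_ge0 //= -subr_ge0.
  have -> : 1 - (l1 t + w (s, t) * (1 - l1 t)) = (1 - l1 t) * (1 - w (s, t)).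
    by ring.
  by rewrite mulr_ge0 // subr_ge0.
- move=> t tI; rewrite /l /ta.
  have -> : u (0, t) = 0 by rewrite /u /= mulr0 clamp_le0.
  have -> : w (0, t) = 0 by rewrite /w /= mulr0 sub0r clamp_le0 // oppr_le0 ler01.
  by rewrite !mul0r subr0 !addr0 !mul1r scale0r scale1r clamp_id // addr0 addrC subrK.
- move=> t tI; rewrite /l /ta.
  have -> : u (1, t) = 1 by rewrite /u /= clamp_ge1 //; lra.
  have -> : w (1, t) = 1 by rewrite /w /= clamp_ge1 //; lra.
  rewrite subrr !mul0r !add0r !mul1r clamp_id // second // -addrA -scalerDl.
  by rewrite subrKC scale1r subrKC.
- move=> s sI; split; rewrite /l /ta /=.
    have -> : t1 0 = 0 by rewrite /t1 mulr0 sub0r clamp_le0 // oppr_le0 ler01.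
    rewrite l10 !mulr0 mulr1 subrK subrr mulr0 scale0r !addr0 scale1r.
    by rewrite clamp_le0 // subrKC.
  have -> : t1 1 = 1 by rewrite /t1 clamp_ge1 //; lra.
  rewrite l11 !mulr1 subrK subrr mulr0 scale0r addr0 scale1r.
  by rewrite clamp_ge1 // subrKC g01.
Qed.

Lemma star_shaped_simply_connected A p : star_shaped p A -> simply_connected A.
Proof.
move=> stA; have [Ap sA] := stA; split; first by exists p.
  move=> x y Ax Ay.
  (* From [x] to the centre up to time 1/2, on to [y] afterwards; at each time at least one of the
     clamped factors is 0. *)
  exists (fun t => p + clamp (1 - 2 * t) *: (x - p) + clamp (2 * t - 1) *: (y - p)).
  have in01 (z : V) (a : R) : A z -> A (p + clamp a *: (z - p)).
    move=> /sA/(_ (clamp_itv a)); congr (A _).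
    by apply/rowP => i; rewrite !mxE; ring.
  split=> [||]; first split.
  - apply: continuous_subspaceT => t.
    have cc (f : R -> R) : continuous f -> forall z : V,
        continuous (fun t => clamp (f t) *: z).
      move=> cf z s; apply: (@continuousZr_tmp _ _ _ (clamp \o f)).
      by apply: continuous_comp; [exact: cf|exact: clamp_continuous].
    apply: (@continuousD _ _ _ (fun t => p + clamp (1 - 2 * t) *: (x - p))).
      apply: (@continuousD _ _ _ (fun=> p)); first exact: cst_continuous.
      apply: cc => s; apply: cvgB; first exact: cvg_cst.
      by apply: cvgM; [exact: cvg_cst|exact: cvg_id].
    apply: cc => s; apply: cvgB; last exact: cvg_cst.
    by apply: cvgM; [exact: cvg_cst|exact: cvg_id].
  - move=> t _; have [t2|t2] := leP (2 * t) 1.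
      by rewrite (clamp_le0 (t := 2 * t - 1)) ?subr_le0 // scale0r addr0; exact: in01.
    rewrite clamp_le0 ?subr_le0 ?(ltW t2) // scale0r addr0; exact: in01.
  - rewrite mulr0 subr0 sub0r clamp_ge1 // clamp_le0 ?oppr_le0 ?ler01 //.
    by rewrite scale1r scale0r addr0 subrKC.
  - rewrite mulr1 clamp_le0 ?clamp_ge1 ?scale0r ?scale1r ?addr0 ?subrKC //; lra.
by move=> g; exact: (star_shaped_null_homotopic stA).
Qed.

Lemma continuous_affine_path p x : continuous (fun t => p + t *: (x - p)).
Proof.
rewrite (_ : (fun t => _) = fun t => t *: x + (1 - t) *: p).
  exact: segment_path_continuous.
by apply/funext => t; apply/rowP => i; rewrite !mxE; ring.
Qed.

(** A union of six half-spaces. Each is paired with the positive half-space of the next axis, which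
    it meets, so that all pairs share the corner [const_mx M]. *)
Lemma exterior_connected (M : R) : connected [set x : V | exists i, M <= `|x 0 i|].
Proof.
pose sg (b : bool) : R := if b then 1 else -1.
pose S (k : 'I_3 * bool) := [set x : V | M <= sg k.2 * x 0 k.1].
have cS k : connected (S k).
  apply: (@star_shaped_connected _ (const_mx (sg k.2 * M))).
  split=> [|x t xS /andP[t0 t1]].
    by rewrite /S /= mxE mulrA; case: k => i [] /=; rewrite ?mulrNN !mul1r.
  by move: xS; rewrite /S /= !mxE; case: k => i [] /= xM; nra.
pose F k := S k `|` S (ordS k.1, true).
have -> : [set x : V | exists i, M <= `|x 0 i|] = \bigcup_(k in setT) F k.
  apply/seteqP; split=> [x [i]|x [[i b] _]].
    rewrite real_ler_normr ?num_real // => /orP[xM|xM].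
      by exists (i, true) => //; left; rewrite /S /= mul1r.
    by exists (i, false) => //; left; rewrite /S /= mulN1r.
  have SE j c : S (j, c) x -> exists i0, M <= `|x 0 i0|.
    rewrite /S /= => xM; exists j; apply: le_trans xM _.
    case: c; rewrite /= ?mul1r ?mulN1r; first exact: ler_norm.
    by rewrite -normrN ler_norm.
  by case=> xS; exact: SE xS.
apply: bigcup_connected => [|[i b] _].
  by exists (const_mx M) => -[i b] _; right; rewrite /S /= mxE mul1r.
apply: connectedU => //; exists (\row_j if j == i then sg b * M else M).
rewrite /S; split; rewrite /= mxE ?eqxx.
  by rewrite mulrA; case: b; rewrite /= ?mulrNN !mul1r.
by rewrite mul1r ifN //; case: i => -[|[|[|]]].
Qed.

(** A ray pointing away from the centre cannot re-enter a star-shaped set, and it runs into the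
    connected outside of a large cube. *)
Lemma star_shaped_complement_connected A p : bounded_set A -> star_shaped p A ->
  connected (~` A).
Proof.
move=> /ex_strict_bound_gt0[M M0 AM] [Ap sA].
pose E := [set x : V | exists i, M <= `|x 0 i|].
pose F x := (fun t => p + t *: (x - p)) @` `[1, +oo[ `|` E.
have -> : ~` A = \bigcup_(x in ~` A) F x.
  apply/seteqP; split=> [x Ax|y [x Ax [[t + <-] Ay|[i Mi] /AM]]].
  - exists x => //; left; exists 1; first by rewrite /= in_itv /= lexx.
    by rewrite scale1r subrKC.
  - rewrite /= in_itv /= andbT => t1; apply: Ax.
    have t0 : 0 < t by apply: lt_le_trans t1.
    have := sA _ t^-1 Ay; rewrite invr_ge0 ltW //= invf_le1 // => /(_ t1).
    congr (A _); rewrite scalerDr scalerA mulVf ?gt_eqF // scale1r.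
    by apply/rowP => i; rewrite !mxE; ring.
  - rewrite /= ltNge => /negP; apply; apply: le_trans Mi _.
    rewrite [leRHS]/Num.norm /= mx_normrE; apply/bigmax_geP; right => /=.
    by exists (0, i).
apply: bigcup_connected => [|x Ax].
  exists (const_mx M) => x _; right; exists 0.
  by rewrite mxE ger0_norm // ltW.
apply: connectedU; last exact: exterior_connected.
  have xp : x - p != 0 by rewrite subr_eq0; apply/eqP => xp; apply: Ax; rewrite xp.
  have /rV0Pn[i xi] := xp.
  have xi0 : 0 < `|(x - p) 0 i| by rewrite normr_gt0.
  (* Far enough along the ray for the coordinate [i], in which [x] and [p] differ, to reach absolute
     value [M]. *)
  pose t := 1 + (M + `|p 0 i|) / `|(x - p) 0 i|.
  exists (p + t *: (x - p)); split.
    exists t => //; rewrite /= in_itv /= andbT lerDl divr_ge0 ?addr_ge0 //.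
    exact: ltW.
  exists i; have -> : (p + t *: (x - p)) 0 i = t * (x - p) 0 i + p 0 i.
    by rewrite !mxE addrC.
  apply: le_trans (lerB_normD _ _); rewrite normrM lerBrDr.
  have t0 : 0 <= t by rewrite addr_ge0 // divr_ge0 // addr_ge0 // ltW.
  by rewrite (ger0_norm t0) mulrDl mul1r divfK ?gt_eqF // lerDr.
apply: connected_continuous_connected.
  by apply/connected_intervalP; exact: interval_is_interval.
exact/continuous_subspaceT/continuous_affine_path.
Qed.

End StarShaped.

(** * Meshes from separating functionals *)

Section Meshes.
Variable R : realType.
Local Notation V := 'rV[R]_3.
Implicit Types (v w : hexa R) (l : 'cV[R]_3).

Lemma separated_hulls v w l c : (forall x, lf l (v x) < c) ->
  (forall x, c <= lf l (w x)) ->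
  convex_hull (range v) `&` convex_hull (range w) = set0.
Proof.
move=> vc wc; apply/seteqP; split=> // y [vy wy].
have yc : lf l y = c.
  apply/eqP; rewrite eq_le; apply/andP; split.
    by apply: convex_hull_le vy => _ [x _ <-]; exact: ltW.
  by apply: convex_hull_ge wy => _ [x _ <-].
have vle z : range v z -> lf l z <= c by move=> [x _ <-]; exact: ltW.
have := convex_hull_supporting vle vy yc.
apply: (@convex_hull_min _ _ set0).
  by apply/convex_segment.
by move=> _ [[x _ <-]] /= xc; have := vc x; rewrite xc ltxx.
Qed.

(** The hulls lie on opposite sides of the plane, so common points lie in it and hence in the face
    of [v] that it supports. Conversely, that face has the same vertices as a face of [w]. *)
Lemma separated_hulls_face v w l c D E x y :
  (forall z, lf l (v z) <= c) -> (forall z, c <= lf l (w z)) ->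
  (forall z, lf l (v z) = c -> cube_face D x z) ->
  v @` cube_face D x = w @` cube_face E y ->
  convex_hull (range v) `&` convex_hull (range w) = face v D x.
Proof.
move=> vc wc vx vw; apply/seteqP; split=> [z [vz wz]|z zx].
  have zc : lf l z = c.
    apply/eqP; rewrite eq_le; apply/andP; split.
      by apply: convex_hull_le vz => _ [t _ <-].
    by apply: convex_hull_ge wz => _ [t _ <-].
  have vle u : range v u -> lf l u <= c by move=> [t _ <-].
  apply: convex_hullS (convex_hull_supporting vle vz zc).
  by move=> _ [[t _ <-]] /= tc; exists t => //; exact: vx.
split; first by apply: convex_hullS zx => _ [t _ <-]; exists t.
move: zx; rewrite /face vw; apply: convex_hullS => _ [t _ <-]; by exists t.
Qed.

Lemma separated_cells v w l c : l != 0 ->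
  (forall x, lf l (v x) <= c) -> (forall x, c <= lf l (w x)) ->
  cell v `&` cell w = set0.
Proof.
move=> l0 vc wc; apply/seteqP; split=> // y [].
move=> /(interior_lt l0 (c := c)) yc /(interior_lt (a := - l) (c := - c)) cy.
have /yc : forall x, convex_hull (range v) x -> lf l x <= c.
  by apply: convex_hull_le => _ [x _ <-].
have : lf (- l) y < - c.
  apply: cy; first by rewrite oppr_eq0.
  move=> x; rewrite lf_oppc lerN2; apply: convex_hull_ge => _ [t _ <-]; exact: wc.
by rewrite lf_oppc ltrN2 => /lt_trans /[apply]; rewrite ltxx.
Qed.

Definition mesh_body n (T : hexas R n) : set V :=
  \bigcup_(i in [set: 'I_n]) convex_hull (range (T i)).

Section Body.
Variables (n : nat) (T : hexas R n).
Hypothesis hT : forall i, is_hexahedron (T i).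

Lemma mesh_body_closed : closed (mesh_body T).
Proof. apply: closed_bigcup => [|i _]; [exact: finite_finset|exact: hexahedron_closed]. Qed.

Lemma mesh_body_bounded : bounded_set (mesh_body T).
Proof.
pose v (p : 'I_n * cube_vertex) := T p.1 p.2.
have [M [Mr MP]] := compact_bounded (@convex_hull_compact _ _ v : compact _).
exists M; split=> // M1 /MP MM x [i _ Tx]; apply: MM.
by apply: convex_hullS Tx => _ [y _ <-]; exists (i, y).
Qed.

Lemma mesh_body_interior_bounded : bounded_set (mesh_body T)°.
Proof.
have [M [Mr MP]] := mesh_body_bounded; exists M; split=> // M1 /MP MM x.
by move=> /interior_subset; exact: MM.
Qed.

Lemma mesh_body_bigcup_cell :
  closure (\bigcup_(i in [set: 'I_n]) cell (T i)) = mesh_body T.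
Proof.
apply/seteqP; split.
  have /closure_id -> := mesh_body_closed; apply: closureS.
  by move=> x [i _ /interior_subset]; exists i.
move=> x [i _]; rewrite -(closure_cell (hT i)); apply: closureS.
by move=> y Ty; exists i.
Qed.

Lemma cells_sub_interior :
  \bigcup_(i in [set: 'I_n]) cell (T i) `<=` (mesh_body T)°.
Proof. by move=> x [i _]; apply: interiorS => y Ty; exists i. Qed.

Lemma closure_mesh_body_interior : closure (mesh_body T)° = mesh_body T.
Proof.
apply/seteqP; split; last first.
  rewrite -{1}mesh_body_bigcup_cell; apply: closureS; exact: cells_sub_interior.
have /closure_id {2}-> := mesh_body_closed; apply: closureS.
exact: interior_subset.
Qed.

Hypothesis linked : forall i : 'I_n, (0 < i)%N ->
  exists2 j : 'I_n, (j < i)%N & exists y, [/\ convex_hull (range (T i)) y,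
    convex_hull (range (T j)) y &
    (convex_hull (range (T i)) `|` convex_hull (range (T j)))° y].

(** Two linked open cells together with the point [y] form a connected part of the interior, so by
    induction every open cell lies in the component of cell 0. The open cells are dense in the body,
    so this component is everything. *)
Lemma mesh_body_connected : connected (mesh_body T)°.
Proof.
have [n0|n0] := posnP n.
  rewrite (_ : _° = set0); first exact: connected0.
  apply/seteqP; split=> // x /interior_subset[i _].
  by have := leq_ltn_trans (leq0n i) (ltn_ord i); rewrite n0.
pose i0 : 'I_n := Ordinal n0.
have [p p0] := (hT i0).1.
pose W := connected_component (mesh_body T)° p.
have cellW i : cell (T i) `<=` W.
  elim/ltn_ind: {i}(val i) {-2}i (erefl (val i)) => k IH i ik.
  have cT j q : cell (T j) q -> connected (cell (T j)).
    move=> qj; apply: (star_shaped_connected (p := q)).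
    apply: interior_star_shaped => //; apply: convex_star_shaped.
      exact: convex_hull_convex.
    exact: interior_subset.
  have sub j : cell (T j) `<=` (mesh_body T)°.
    by apply: subset_trans cells_sub_interior => x jx; exists j.
  have [i00|ipos] := posnP (val i).
    have -> : i = i0 by apply/val_inj.
    apply: connected_component_max; [exact: p0|exact: sub|exact: cT p0].
  have [j ji [y [iy jy ijy]]] := linked ipos.
  have yB : (mesh_body T)° y.
    by apply: interiorS ijy => z [iz|jz]; [exists i|exists j].
  have [q jq] := (hT j).1.
  have [q' iq] := (hT i).1.
  have cy k' r : convex_hull (range (T k')) y -> cell (T k') r ->
      connected (cell (T k') `|` [set y]).
    move=> ky kr; apply: (connected_between (cT _ _ kr)); first by left.
    move=> z [kz|->]; first exact: subset_closure.
    by rewrite (closure_cell (hT k')).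
  have subC : (cell (T j) `|` [set y]) `|` (cell (T i) `|` [set y]) `<=`
      connected_component (mesh_body T)° q.
    apply: connected_component_max; first by left; left.
      by move=> z [[/sub|->]|[/sub|->]].
    apply: connectedU; [by exists y; split; right|exact: cy jq|exact: cy iq].
  have jk : (val j < k)%N by rewrite -ik.
  have pq : W q by apply: (IH _ jk j erefl).
  move=> z iz; apply: connected_component_trans pq _.
  by apply: subC; right; left.
apply: (connected_between (component_connected (A := (mesh_body T)°) (x := p))).
  exact: connected_component_sub.
apply: subset_trans (@interior_subset _ _) _.
rewrite -{1}mesh_body_bigcup_cell; apply: closureS => x [i _]; exact: cellW.
Qed.

Lemma hex_mesh_body : (0 < n)%N ->
  (forall i j, i != j -> cell (T i) `&` cell (T j) = set0) ->
  (forall i j, i != j -> conforming (T i) (T j)) ->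
  hex_mesh T (mesh_body T)°.
Proof.
move=> n0 dT cT; split=> //; last first.
  rewrite closure_mesh_body_interior; apply: eq_bigcupr => i _.
  exact: closure_cell.
split.
- exact: open_interior.
- exact: mesh_body_interior_bounded.
- have [p p0] := (hT (Ordinal n0)).1.
  by exists p; apply: cells_sub_interior; exists (Ordinal n0).
- exact: mesh_body_connected.
- by rewrite closure_mesh_body_interior.
Qed.

End Body.
End Meshes.

(** * Closed strings *)

Section QuarterTurn.
Implicit Types (x : cube_vertex) (b : bool).

Lemma setcC x d e b c : d != e -> setc (setc x d b) e c = setc (setc x e c) d b.
Proof.
move=> de; apply/ffunP => f; rewrite !ffunE.
by case: (eqVneq f e) => [->|]; rewrite // eq_sym (negbTE de).
Qed.

Lemma quarter_turn_setc0 x b :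
  quarter_turn (setc x 0 b) = setc (quarter_turn x) 1 b.
Proof. by apply/ffunP => -[[|[|[|//]]] lt3]; rewrite !ffunE. Qed.

Lemma quarter_turn_setc1 x b :
  quarter_turn (setc x 1 b) = setc (quarter_turn x) 0 (~~ b).
Proof. by apply/ffunP => -[[|[|[|//]]] lt3]; rewrite !ffunE. Qed.

Lemma quarter_turn_inj : injective quarter_turn.
Proof.
move=> x y /ffunP xy; apply/ffunP => d.
have := xy 0; have := xy 1; have := xy string_axis; rewrite !ffunE /=.
case: d => -[|[|[|//]]] lt3 x2 x1 x0.
- by rewrite (_ : Ordinal lt3 = 0) //; apply/val_inj.
- by rewrite (_ : Ordinal lt3 = 1) //; [exact: negb_inj|apply/val_inj].
- by rewrite (_ : Ordinal lt3 = string_axis) //; apply/val_inj.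
Qed.

End QuarterTurn.

Section Strings.
Variables (R : realType) (n : nat) (T : hexas R n) (Omega : set 'rV[R]_3).
Hypothesis mT : hex_mesh T Omega.

Lemma mesh_hexahedron i : is_hexahedron (T i).
Proof. by case: mT. Qed.
Local Notation hT := mesh_hexahedron.

Lemma mesh_vertex_closure i x : closure (cell (T i)) (T i x).
Proof. by rewrite (closure_cell (hT i)); exact: vertex_hull. Qed.

Section Orientation.
Variable o : 'rV[R]_3 -> 'rV[R]_3 -> bool.
Hypotheses (oo : edge_orientation T o) (co : consistent T o).

Definition class_direction i d :=
  o (edge_tail (T i) d [ffun=> false]) (edge_head (T i) d [ffun=> false]).

(* [s] tells whether the directions of the two labellings of a common edge
   are opposite. *)
Lemma class_direction_shared i d x j e y s :
  T i (setc x d false) = T j (setc y e s) ->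
  T i (setc x d true) = T j (setc y e (~~ s)) ->
  class_direction i d = s (+) class_direction j e.
Proof.
rewrite /class_direction (co i d _ x) (co j e _ y) /edge_tail /edge_head => -> ->.
by case: s => //=; rewrite oo.
Qed.

End Orientation.

Section String.
Variable k : nat.
Hypothesis sT : closed_string T k.

Definition string_turn (i : 'I_n) x :=
  if i.+1 == n then iter k quarter_turn x else x.

Lemma string_turn_inj i : injective (string_turn i).
Proof.
move=> x y; rewrite /string_turn; case: ifP => // _.
by elim: k => //= m IHm /quarter_turn_inj /IHm.
Qed.

Lemma string_attached i x : T i (setc x string_axis true) =
  T (ordS i) (setc (string_turn i x) string_axis false).
Proof.
rewrite /string_turn; have [s1 s2 _] := sT.
by case: eqP => [/s2//|/eqP iN]; apply: s1; rewrite ltn_neqAle iN ltn_ord.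
Qed.

Lemma string_neq_next (i : 'I_n) : i != ordS i.
Proof.
apply/eqP => iS; have := string_attached i [ffun=> false].
rewrite -iS => /(hexahedron_inj (hT i)) /ffunP /(_ string_axis).
by rewrite !setc_same.
Qed.

(** If [string_axis] belonged to [D], some other axis would be fixed by the face, while the vertices
    of the end facet take both values along it. The map [f] accounts for the twist. *)
Lemma cube_face_half (D : {set 'I_3}) x b (f : cube_vertex -> cube_vertex) :
  injective f -> (#|D| <= 2)%N ->
  (forall z, cube_face D x (setc (f z) string_axis b)) ->
  forall z, cube_face D x z -> z string_axis = b.
Proof.
move=> /injF_bij[g fK gK] D2 Dx z Dz.
have aD : string_axis \notin D.
  apply/negP => aD; suff : (#|'I_3| <= #|D|)%N.
    by rewrite card_ord leqNgt ltnS D2.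
  apply/subset_leq_card/fintype.subsetP => d _; apply: contraT => dD.
  have da : d != string_axis by apply: contraNneq dD => ->.
  have := Dx (g [ffun=> ~~ x d]) d dD; rewrite gK setc_neq // ffunE.
  by case: (x d).
by rewrite (Dz _ aD) -(Dx [ffun=> false] _ aD) setc_same.
Qed.

(** Conformity provides some common face. It contains the four attached vertices and has dimension
    at most 2, so it lies in the attached facets. *)
Lemma string_meet i : exists (D E : {set 'I_3}) (x y : cube_vertex),
  [/\ closure (cell (T i)) `&` closure (cell (T (ordS i))) = face (T i) D x,
      closure (cell (T i)) `&` closure (cell (T (ordS i))) = face (T (ordS i)) E y,
      forall z, cube_face D x z -> z string_axis = true &
      forall z, cube_face E y z -> z string_axis = false].
Proof.
have [_ _ _ /(_ _ _ (string_neq_next i))] := mT.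
have meet z : (closure (cell (T i)) `&` closure (cell (T (ordS i))))
    (T i (setc z string_axis true)).
  split; first exact: mesh_vertex_closure.
  by rewrite string_attached; exact: mesh_vertex_closure.
move=> [m0|[D [E [x [y [DE D2 mD mE]]]]] _].
  by have := meet [ffun=> false]; rewrite m0.
exists D, E, x, y; split=> //.
  apply: (cube_face_half (f := id)) => // z; apply: (vertex_face (hT i)).
  by rewrite -mD; exact: meet.
apply: (cube_face_half (@string_turn_inj i)); first by rewrite -DE.
move=> z; apply: (vertex_face (hT (ordS i))).
by rewrite -mE -string_attached; exact: meet.
Qed.

Lemma string_common_vertex i z z' : T i z = T (ordS i) z' ->
  z string_axis = true /\ z' string_axis = false.
Proof.
have [D [E [x [y [mD mE Dx Ey]]]]] := string_meet i => zz'.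
have meet : (closure (cell (T i)) `&` closure (cell (T (ordS i)))) (T i z).
  by split; [|rewrite zz']; exact: mesh_vertex_closure.
split; first by apply/Dx/(vertex_face (hT i)); rewrite -mD.
by apply/Ey/(vertex_face (hT (ordS i))); rewrite -mE -zz'.
Qed.

Lemma class_direction_step o (i : 'I_n) d : edge_orientation T o -> consistent T o ->
  d != string_axis -> (i.+1 < n)%N ->
  class_direction o i d = class_direction o (ordS i) d.
Proof.
move=> oo co da iN; pose x : cube_vertex := [ffun=> false].
rewrite (@class_direction_shared _ oo co i d (setc x string_axis true)
  (ordS i) d (setc x string_axis false) false) //=.
  by rewrite setcC 1?eq_sym // string_attached /string_turn ltn_eqF // setcC.
by rewrite setcC 1?eq_sym // string_attached /string_turn ltn_eqF // setcC.
Qed.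

Lemma class_direction_last o (i : 'I_n) d e s : edge_orientation T o -> consistent T o ->
  d != string_axis -> e != string_axis -> i.+1 = n ->
  (forall x b, iter k quarter_turn (setc x d b) =
     setc (iter k quarter_turn x) e (s (+) b)) ->
  class_direction o i d = s (+) class_direction o (ordS i) e.
Proof.
move=> oo co da ea iN st; pose x : cube_vertex := [ffun=> false].
have tE b : T i (setc (setc x string_axis true) d b) =
    T (ordS i) (setc (setc (iter k quarter_turn x) string_axis false) e (s (+) b)).
  rewrite setcC 1?eq_sym // string_attached /string_turn iN eqxx st.
  by rewrite setcC.
apply: (class_direction_shared oo co (x := setc x string_axis true)
  (y := setc (iter k quarter_turn x) string_axis false)); first by rewrite tE addbF.
by rewrite tE addbT.
Qed.

Lemma class_direction_loop o d e s : edge_orientation T o -> consistent T o ->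
  d != string_axis -> e != string_axis ->
  (forall x b, iter k quarter_turn (setc x d b) =
     setc (iter k quarter_turn x) e (s (+) b)) ->
  forall i0 : 'I_n, val i0 = 0%N ->
  class_direction o i0 d = s (+) class_direction o i0 e.
Proof.
move=> oo co da ea st i0 i00.
have step m : forall i : 'I_n, val i = m ->
    class_direction o i0 d = class_direction o i d.
  elim: m => [|m IHm] i im; first by congr class_direction; apply/val_inj; rewrite i00.
  have mn : (m.+1 < n)%N by rewrite -im; exact: ltn_ord.
  rewrite (IHm (Ordinal (ltnW mn)) erefl) (class_direction_step oo co) //=.
  by congr class_direction; apply/val_inj; rewrite /= modn_small // im.
have n0 : (0 < n)%N by apply: leq_ltn_trans (ltn_ord i0).
have ln : (n.-1 < n)%N by rewrite prednK.
rewrite (step _ (Ordinal ln) erefl) (class_direction_last oo co da ea _ st) /=.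
  by congr (_ (+) class_direction _ _ _); apply/val_inj; rewrite /= prednK // modnn.
by rewrite prednK.
Qed.

(** Two quarter turns reverse each class of the cross section in one round. One or three exchange
    the two classes, reversing on one of the passages, so two rounds bring a class back reversed. *)
Lemma twisted_string_not_orientable : (0 < k < 4)%N -> ~ consistently_orientable T.
Proof.
move=> k4 [dir [oo co]].
have n0 : (0 < n)%N.
  case: mT => [[_ _ [p Op] _ _] _ _ _ TO].
  have : closure Omega p by exact: subset_closure.
  by rewrite -TO => -[i _ _]; exact: leq_ltn_trans (ltn_ord i).
have loop d e s := @class_direction_loop dir d e s oo co.
pose c d := class_direction dir (Ordinal n0) d.
have := k4; case kE: k => [|[|[|[|//]]]] // _.
- have c1 : c 1 = true (+) c 0.
    by apply: loop => // x b; rewrite kE /= quarter_turn_setc1.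
  have c0 : c 0 = false (+) c 1.
    by apply: loop => // x b; rewrite kE /= quarter_turn_setc0.
  by move: c1; rewrite c0; case: (c 1).
- have : c 0 = true (+) c 0.
    apply: loop => // x b.
    by rewrite kE /= !(quarter_turn_setc0, quarter_turn_setc1).
  by case: (c 0).
- have c0 : c 0 = true (+) c 1.
    apply: loop => // x b.
    by rewrite kE /= !(quarter_turn_setc0, quarter_turn_setc1).
  have c1 : c 1 = false (+) c 0.
    apply: loop => // x b.
    by rewrite kE /= !(quarter_turn_setc0, quarter_turn_setc1) negbK.
  by move: c0; rewrite c1; case: (c 0).
Qed.

(** Without a twist a vertex of the attached facets has the same cross section labels in both cells,
    so increasing labels mean the same direction. *)
Lemma common_edge_not_reversed i d x e y : k = 0%N ->
  T i (setc x d true) = T (ordS i) (setc y e false) ->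
  T i (setc x d false) = T (ordS i) (setc y e true) -> False.
Proof.
move=> k0 Tt Tf.
have turn z : string_turn i z = z by rewrite /string_turn k0; case: ifP.
have [t1 _] := string_common_vertex Tt; have [t0 _] := string_common_vertex Tf.
have da : d != string_axis.
  by apply/eqP => da; move: t1 t0; rewrite da !setc_same.
move: Tt Tf; rewrite -(setc_id (setc x d true) string_axis) t1.
rewrite -(setc_id (setc x d false) string_axis) t0 !string_attached !turn.
move=> /(hexahedron_inj (hT _)) /ffunP/(_ d) + /(hexahedron_inj (hT _)) /ffunP/(_ d).
rewrite !(setc_neq _ _ da) !setc_same !ffunE.
by case: eqP => // _ <-.
Qed.

Lemma untwisted_string_orientable : k = 0%N -> consistently_orientable T.
Proof.
move=> k0.
exists (fun p q => `[< exists i d x, p = edge_tail (T i) d x /\ q = edge_head (T i) d x >]).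
have fwd i d x : `[< exists i' d' x', edge_tail (T i) d x = edge_tail (T i') d' x' /\
    edge_head (T i) d x = edge_head (T i') d' x' >] = true.
  by apply/asboolT; exists i, d, x.
split=> [i d x|i d x y]; rewrite !fwd //=.
apply/asboolP => -[j [e [y []]]]; rewrite /edge_head /edge_tail => ht th.
have [ji|ji] := eqVneq j i.
  move: ht th; rewrite ji => /(hexahedron_inj (hT _)) /ffunP/(_ d) +
    /(hexahedron_inj (hT _)) /ffunP/(_ d).
  by rewrite !setc_same !ffunE; case: eqP => // _ <-.
have [jS|jS] := eqVneq j (ordS i).
  by apply: (@common_edge_not_reversed i d x e y) => //; rewrite -jS.
have [iS|iS] := eqVneq i (ordS j).
  by apply: (@common_edge_not_reversed j e y d x) => //; rewrite -iS.
have [_ _ /(_ i j)] := sT; rewrite eq_sym => /(_ ji jS iS) /seteqP[+ _].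
move=> /(_ (T i (setc x d true))); apply; split; first exact: mesh_vertex_closure.
by rewrite ht; exact: mesh_vertex_closure.
Qed.

End String.
End Strings.

(** * Bodies of cells that are star-shaped about the origin *)

Section StarBody.
Variables (R : realType) (n : nat) (T : hexas R n).
Variables (a : 'I_n -> 'I_3 -> bool -> 'cV[R]_3) (c : 'I_n -> 'I_3 -> bool -> R).
Hypothesis f : forall i d b, facet_plane (T i) d b (a i d b) (c i d b).

(* The segment from a point of a cell to the origin leaves the cell through a
   facet that has the origin strictly on its outer side, so it enters a cell of
   smaller index. *)
Lemma star_shaped_mesh_body : (0 < n)%N ->
  (forall i d b, 0 <= c i d b \/ exists2 j : 'I_n, (j < i)%N &
     forall x : cube_vertex, x d = b -> exists y, T i x = T j y) ->
  star_shaped 0 (mesh_body T).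
Proof.
move=> n0 exits; split.
  exists (Ordinal n0) => //; rewrite (hexahedron_halfspaces (f _)) => d b.
  have [c0|[j]//] := exits (Ordinal n0) d b.
  by rewrite /lf mul0mx mxE.
move=> x t [i _ Tx] t01; rewrite scaler0 addr0.
elim/ltn_ind: {i}(val i) {-2}i (erefl (val i)) x t t01 Tx => m IH i im x t.
move=> /andP[t0 t1] Tx.
have xc d b : lf (a i d b) x <= c i d b.
  by move: Tx; rewrite (hexahedron_halfspaces (f i)); apply.
pose viol (p : 'I_3 * bool) := c i p.1 p.2 < t * lf (a i p.1 p.2) x.
have [p0 vp0|novi] := pickP viol; last first.
  exists i => //; rewrite (hexahedron_halfspaces (f i)) => d b.
  by rewrite lfZ leNgt; have := novi (d, b); rewrite /viol /= => ->.
have viol_lt p : viol p -> lf (a i p.1 p.2) x < 0 /\ c i p.1 p.2 < 0.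
  rewrite /viol => vp; have := xc p.1 p.2; set s := lf _ _ in vp * => sc.
  have s0 : s < 0.
    rewrite ltNge; apply/negP => s0.
    by have := lt_le_trans vp (le_trans (ler_piMl s0 t1) sc); rewrite ltxx.
  by split=> //; apply: lt_le_trans vp _; rewrite mulr_ge0_le0 // ltW.
(* The parameter at which the segment from [x] to the origin crosses the plane [p]. Among the planes
   that [t *: x] violates, the largest parameter belongs to the one crossed earliest on the way to
   the origin. *)
pose mu p := c i p.1 p.2 / lf (a i p.1 p.2) x.
have [p vp pmax] := @Order.TotalTheory.arg_maxP _ R _ p0 viol mu vp0.
have [s0 c0] := viol_lt p vp.
set s := lf (a i p.1 p.2) x in s0.
have mus : mu p * s = c i p.1 p.2 by rewrite /mu divfK // lt_eqF.
have tmu : t < mu p by rewrite /mu ltr_ndivlMr.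
have mu1 : mu p <= 1 by rewrite /mu ler_ndivrMr // mul1r; exact: xc.
have mu0 : 0 < mu p by apply: le_lt_trans tmu.
have Ty : convex_hull (range (T i)) (mu p *: x).
  rewrite (hexahedron_halfspaces (f i)) => d b; rewrite lfZ.
  have xdb := xc d b.
  have [vdb|] := boolP (viol (d, b)).
    have [/= sdb _] := viol_lt _ vdb.
    by have := pmax _ vdb; rewrite {1}/mu /= ler_ndivrMr.
  rewrite /viol -leNgt /= => tdb; have [s'0|s'0] := leP 0 (lf (a i d b) x).
    exact: le_trans (ler_piMl s'0 mu1) xdb.
  by apply: le_trans tdb; rewrite ler_wnM2r // ltW.
have [|[j ji face_ij]] := exits i p.1 p.2; first by rewrite leNgt c0.
have Tle z : range (T i) z -> lf (a i p.1 p.2) z <= c i p.1 p.2.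
  by move=> [y _ <-]; exact: facet_plane_le (f i _ _).
have yc : lf (a i p.1 p.2) (mu p *: x) = c i p.1 p.2 by rewrite lfZ.
have yj : convex_hull (range (T j)) (mu p *: x).
  apply: convex_hullS (convex_hull_supporting Tle Ty yc).
  move=> _ [[z _ <-]] /= zc; have := f i p.1 p.2 z.
  case: eqP => [zp _|_]; last by rewrite zc ltxx.
  by have [y ->] := face_ij z zp; exists y.
have jm : (val j < m)%N by rewrite -im.
have := IH _ jm j erefl (mu p *: x) (t / mu p) _ yj.
rewrite scalerA divfK ?gt_eqF //; apply.
by rewrite divr_ge0 ?(ltW mu0) //= ler_pdivrMr // mul1r ltW.
Qed.

End StarBody.

(** * Integer certificates *)

Definition point : Type := (int * int * int)%type.
Definition label : Type := (bool * bool * bool)%type.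
Definition table : Type := label -> point.

Definition dot (a p : point) : int := a.1.1 * p.1.1 + a.1.2 * p.1.2 + a.2 * p.2.
Definition addp (p q : point) : point := (p.1.1 + q.1.1, p.1.2 + q.1.2, p.2 + q.2).
Definition oppp (p : point) : point := (- p.1.1, - p.1.2, - p.2).
Definition crossp (p q : point) : point :=
  (p.1.2 * q.2 - p.2 * q.1.2, p.2 * q.1.1 - p.1.1 * q.2, p.1.1 * q.1.2 - p.1.2 * q.1.1).

Definition labels : seq label :=
  [seq (p, z) | p <- [seq (x, y) | x <- [:: false; true], y <- [:: false; true]],
    z <- [:: false; true]].

Definition axis (d : nat) (z : label) : bool :=
  match d with 0%N => z.1.1 | 1%N => z.1.2 | _ => z.2 end.
Definition relabel (d : nat) (z : label) (b : bool) : label :=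
  match d with 0%N => (b, z.1.2, z.2) | 1%N => (z.1.1, b, z.2) | _ => (z.1.1, z.1.2, b) end.

Definition axes : seq nat := [:: 0; 1; 2]%N.
Definition signs : seq bool := [:: false; true].

Definition table_of (l : seq point) : table :=
  fun z => nth (0, 0, 0) l (4 * z.1.1 + 2 * z.1.2 + z.2).

(* Agrees with [ts] below [n]; the values of all tables are shared by the
   computations below. *)
Definition tabulate n (ts : nat -> table) : nat -> table :=
  let l := [seq [seq ts i z | z <- labels] | i <- iota 0 n] in
  fun i => table_of (nth [::] l i).

Definition facet_ok (t : table) d b (a : point) (c : int) : bool :=
  all (fun z => if axis d z == b then dot a (t z) == c else dot a (t z) < c) labels.

(** Cross product of two edges of the facet at a vertex, directed outwards by means of the
    neighbouring vertex off the facet. It is a mere candidate, which [facet_ok] tests at all eight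
    vertices. *)
Definition facet_normal (t : table) d b : point * int :=
  let z := relabel d (false, false, false) b in
  let e := if d is 0%N then 1%N else 0%N in
  let e' := if d is 2%N then 1%N else 2%N in
  let side e := addp (t (relabel e z true)) (oppp (t z)) in
  let a := crossp (side e) (side e') in
  let c := dot a (t z) in
  if dot a (t (relabel d z (~~ b))) < c then (a, c) else (oppp a, - c).

Definition hexahedron_ok (t : table) : bool :=
  all (fun d => all (fun b =>
    facet_ok t d b (facet_normal t d b).1 (facet_normal t d b).2) signs) axes.

Definition bounded_by (t u : table) (a : point) (c : int) : bool :=
  all (fun z => dot a (t z) <= c) labels && all (fun z => c <= dot a (u z)) labels.

Definition strictly_bounded_by (t u : table) (a : point) (c : int) : bool :=
  all (fun z => dot a (t z) < c) labels && all (fun z => c <= dot a (u z)) labels.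

Definition face_label (D x z : label) : bool :=
  all (fun d => axis d D || (axis d z == axis d x)) axes.

Definition sub_points (t u : table) (P Q : pred label) : bool :=
  all (fun z => P z ==> has (fun z' => Q z' && (t z == u z')) labels) labels.

Definition dim_label (D : label) : nat := (D.1.1 + D.1.2 + D.2)%N.

(** The face is guessed from the touching vertices: its axes are those along which their labels
    vary. Since the guess is tested afterwards, the default values of [head] do no harm. *)
Definition common_face_ok (t u : table) (a : point) (c : int) : bool :=
  let touch (v : table) := [seq z <- labels | dot a (v z) == c] in
  let free s x : label := (has (fun z => z.1.1 != x.1.1) s,
    has (fun z => z.1.2 != x.1.2) s, has (fun z => z.2 != x.2) s) in
  let x := head (false, false, false) (touch t) in
  let y := head (false, false, false) (touch u) in
  let D := free (touch t) x in let E := free (touch u) y in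
  [&& all (face_label D x) (touch t), dim_label D == dim_label E,
    (dim_label D <= 2)%N, sub_points t u (face_label D x) (face_label E y) &
    sub_points u t (face_label E y) (face_label D x)].

Definition max_dot (a : point) (t : table) : int :=
  foldr (fun z m => Num.max (dot a (t z)) m) (dot a (t (false, false, false))) labels.

(** All values are integers, so lying strictly above the maximum on [t] means lying above that
    maximum plus one. *)
Definition disjoint_ok (cands : seq point) (t u : table) : bool :=
  has (fun a => strictly_bounded_by t u a (max_dot a t + 1)) cands.

Definition pair_ok (cands : seq point) (t u : table) : bool :=
  has (fun a => let c := max_dot a t in
    (a != (0, 0, 0)) && bounded_by t u a c &&
    (strictly_bounded_by t u a (c + 1) || common_face_ok t u a c)) cands.

Definition link_ok (t u : table) : bool :=
  has (fun d => has (fun b => has (fun e => has (fun b' =>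
    let ac := facet_normal t d b in
    [&& facet_ok u e b' (oppp ac.1) (- ac.2),
      sub_points t u (fun z => axis d z == b) (fun z => axis e z == b') &
      sub_points u t (fun z => axis e z == b') (fun z => axis d z == b)])
    signs) axes) signs) axes.

Section Tables.
Variable R : realType.
Implicit Types (a p q : point) (t u : table) (x : cube_vertex).

Definition vec p : 'rV[R]_3 :=
  \row_(i < 3) (nth 0 [:: p.1.1; p.1.2; p.2] i)%:~R.
Definition covec a : 'cV[R]_3 := (vec a)^T.

Definition label_of x : label := (x 0, x 1, x string_axis).
Definition vertex_of (z : label) : cube_vertex := [ffun d : 'I_3 => axis d z].
Definition hexa_of t : hexa R := fun x => vec (t (label_of x)).

Lemma lf_vec a p : lf (covec a) (vec p) = (dot a p)%:~R.
Proof.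
rewrite lfE !mxE /= /dot !intrD !intrM.
by congr (_ + _ + _); rewrite mulrC.
Qed.

Lemma covec_opp a : covec (oppp a) = - covec a.
Proof.
apply/matrixP => -[[|[|[|//]]] lt3] j; rewrite !mxE /= ?intrN //.
Qed.

Lemma vecD p q : vec (addp p q) = vec p + vec q.
Proof. by apply/rowP => -[[|[|[|//]]] lt3]; rewrite !mxE /= intrD. Qed.

Lemma vecN p : vec (oppp p) = - vec p.
Proof. by apply/rowP => -[[|[|[|//]]] lt3]; rewrite !mxE /= ?intrN. Qed.

Lemma vec_inj : injective vec.
Proof.
move=> [[p0 p1] p2] [[q0 q1] q2] /rowP pq.
have := pq 0; have := pq 1; have := pq ord_max; rewrite !mxE /=.
by move=> /intr_inj -> /intr_inj -> /intr_inj ->.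
Qed.

Lemma covec_neq0 a : a != (0, 0, 0) -> covec a != 0.
Proof.
apply: contraNneq => a0; apply/eqP/vec_inj/trmx_inj; rewrite -/(covec _) a0.
by apply/matrixP => -[[|[|[|//]]] lt3] j; rewrite !mxE.
Qed.

Lemma label_ofK : cancel label_of vertex_of.
Proof.
move=> x; apply/ffunP => -[[|[|[|//]]] lt3]; rewrite ffunE /=;
  by congr (fun_of_fin x _); apply/val_inj.
Qed.

Lemma vertex_ofK : cancel vertex_of label_of.
Proof. by case=> -[z0 z1] z2; rewrite /label_of !ffunE. Qed.

Lemma axis_label (d : 'I_3) x : axis d (label_of x) = x d.
Proof. by rewrite -{2}(label_ofK x) ffunE. Qed.

Lemma mem_labels (z : label) : z \in labels.
Proof. by case: z => -[[] []] []. Qed.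

Lemma all_labels (P : pred label) x : all P labels -> P (label_of x).
Proof. by move=> /allP; apply; exact: mem_labels. Qed.

Lemma mem_axes (d : 'I_3) : val d \in axes.
Proof. by case: d => -[|[|[|]]]. Qed.

Lemma mem_signs (b : bool) : b \in signs.
Proof. by case: b. Qed.

Lemma facet_okP t (d : 'I_3) b a c : facet_ok t d b a c ->
  facet_plane (hexa_of t) d b (covec a) c%:~R.
Proof.
move=> ok x; have := all_labels x ok; rewrite axis_label /hexa_of lf_vec.
by case: ifP => _; [move/eqP->|rewrite ltr_int].
Qed.

Definition normal t (d : 'I_3) b : 'cV[R]_3 := covec (facet_normal t d b).1.
Definition offset t (d : 'I_3) b : R := (facet_normal t d b).2%:~R.

Lemma hexahedron_okP t d b : hexahedron_ok t ->
  facet_plane (hexa_of t) d b (normal t d b) (offset t d b).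
Proof.
move=> /allP/(_ _ (mem_axes d))/allP/(_ _ (mem_signs b)); exact: facet_okP.
Qed.

Lemma is_hexahedron_ok t : hexahedron_ok t -> is_hexahedron (hexa_of t).
Proof.
move=> ok; apply: (is_hexahedron_planes (a := normal t) (c := offset t)) => d b.
exact: hexahedron_okP.
Qed.

Lemma sub_pointsP t u (P Q : pred label) (A B : set cube_vertex) :
  sub_points t u P Q -> (forall x, A x -> P (label_of x)) ->
  (forall x, Q (label_of x) -> B x) ->
  hexa_of t @` A `<=` hexa_of u @` B.
Proof.
move=> ok AP QB _ [x /AP Px <-]; have := all_labels x ok.
rewrite Px => /hasP[z _ /andP[Qz /eqP tz]]; exists (vertex_of z).
  by apply: QB; rewrite vertex_ofK.
by rewrite /hexa_of vertex_ofK tz.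
Qed.

Lemma strictly_bounded_byP t u a c : strictly_bounded_by t u a c ->
  convex_hull (range (hexa_of t)) `&` convex_hull (range (hexa_of u)) = set0.
Proof.
move=> /andP[ta ua]; apply: (@separated_hulls _ _ _ (covec a) c%:~R) => x.
  by rewrite /hexa_of lf_vec ltr_int; exact: (all_labels x ta).
by rewrite /hexa_of lf_vec ler_int; exact: (all_labels x ua).
Qed.

Definition axis_set (D : label) : {set 'I_3} := finset (fun d : 'I_3 => axis d D).

Lemma card_axis_set D : #|axis_set D| = dim_label D.
Proof.
rewrite /axis_set cardsE -sum1_card big_mkcond !big_ord_recl big_ord0 /=.
by case: D => -[[] []] [].
Qed.

Lemma face_labelP D z x :
  cube_face (axis_set D) (vertex_of z) x <-> face_label D z (label_of x).
Proof.
split=> [xz|/allP ok d].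
  apply/allP => d; rewrite !inE => d3.
  have {}d3 : (d < 3)%N by case/or3P: d3 => /eqP->.
  have := xz (Ordinal d3); rewrite inE -{1}axis_label ffunE /=.
  by case: (axis d D) => //= ->.
rewrite inE => /negbTE dD; have := ok _ (mem_axes d).
by rewrite dD axis_label ffunE => /eqP.
Qed.

Lemma pair_okP cands t u : hexahedron_ok t -> hexahedron_ok u ->
  pair_ok cands t u ->
  cell (hexa_of t) `&` cell (hexa_of u) = set0 /\
  conforming (hexa_of t) (hexa_of u).
Proof.
move=> /is_hexahedron_ok ht /is_hexahedron_ok hu /hasP[a _].
move=> /andP[/andP[a0 /andP[tc uc]] ok].
have tle x : lf (covec a) (hexa_of t x) <= (max_dot a t)%:~R.
  by rewrite /hexa_of lf_vec ler_int; exact: (all_labels x tc).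
have ule x : (max_dot a t)%:~R <= lf (covec a) (hexa_of u x).
  by rewrite /hexa_of lf_vec ler_int; exact: (all_labels x uc).
split; first exact: (separated_cells (covec_neq0 a0) tle ule).
rewrite /conforming !closure_cell //; case/orP: ok => [/strictly_bounded_byP|].
  by left.
set c := max_dot a t in tle ule *; rewrite /common_face_ok.
set x := head _ _; set y := head _ _; set D := (_, _, _); set E := (_, _, _).
move=> /and5P[/allP tx DE D2 tu ut]; right.
have tuE : hexa_of t @` cube_face (axis_set D) (vertex_of x) =
    hexa_of u @` cube_face (axis_set E) (vertex_of y).
  by apply/seteqP; split; [apply: (sub_pointsP tu)|apply: (sub_pointsP ut)];
    move=> z /face_labelP.
exists (axis_set D), (axis_set E), (vertex_of x), (vertex_of y).
have meet : convex_hull (range (hexa_of t)) `&` convex_hull (range (hexa_of u)) =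
    face (hexa_of t) (axis_set D) (vertex_of x).
  apply: (separated_hulls_face tle ule _ tuE) => z zc; apply/face_labelP/tx.
  rewrite mem_filter mem_labels andbT.
  by move: zc; rewrite /hexa_of lf_vec => /intr_inj ->.
split=> //; first by rewrite !card_axis_set; exact/eqP.
  by rewrite card_axis_set.
by rewrite meet /face tuE.
Qed.

Lemma link_okP t u : hexahedron_ok t -> hexahedron_ok u -> link_ok t u ->
  exists y, [/\ convex_hull (range (hexa_of t)) y, convex_hull (range (hexa_of u)) y &
   (convex_hull (range (hexa_of t)) `|` convex_hull (range (hexa_of u)))° y].
Proof.
move=> ht hu /hasP[d d3 /hasP[b _ /hasP[e e3 /hasP[b' _]]]] /and3P[ok tu ut].
have lt3 k : k \in axes -> (k < 3)%N by rewrite !inE => /or3P[] /eqP->.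
pose d' := Ordinal (lt3 _ d3); pose e' := Ordinal (lt3 _ e3).
have ft := hexahedron_okP d' b ht.
have fu : facet_plane (hexa_of u) e' b' (- normal t d' b) (- offset t d' b).
  by rewrite -covec_opp -intrN; exact: facet_okP.
apply: (shared_facet_interior (is_hexahedron_ok ht) (is_hexahedron_ok hu) ft fu).
apply/seteqP; split; [apply: (sub_pointsP tu)|apply: (sub_pointsP ut)] => x /=.
- by move=> <-; rewrite -axis_label.
- by rewrite -axis_label => /eqP.
- by move=> <-; rewrite -axis_label.
- by rewrite -axis_label => /eqP.
Qed.

Definition hexas_of n (ts : nat -> table) : hexas R n := fun i => hexa_of (ts i).

Lemma hexas_of_tabulate n ts : @hexas_of n (tabulate n ts) = @hexas_of n ts.
Proof.
apply/funext => i; apply/funext => x; rewrite /hexas_of /hexa_of /tabulate.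
rewrite (nth_map 0%N) ?size_iota ?ltn_ord // nth_iota ?ltn_ord // add0n.
by case: (label_of x) => -[[] []] [].
Qed.

Definition mesh_ok n cands (ts : nat -> table) : bool :=
  [&& all (fun i => hexahedron_ok (ts i)) (iota 0 n),
    all (fun i => all (fun j => (i == j) || pair_ok cands (ts i) (ts j)) (iota 0 n))
      (iota 0 n) &
    all (fun i => (i == 0%N) || has (fun j => link_ok (ts i) (ts j)) (iota 0 i))
      (iota 0 n)].

Section MeshOk.
Variables (n : nat) (cands : seq point) (ts : nat -> table).
Hypothesis ok : mesh_ok n cands ts.

Lemma mesh_ok_hexahedron (i : 'I_n) : hexahedron_ok (ts i).
Proof. by case/and3P: ok => /allP h _ _; apply: h; rewrite mem_iota add0n ltn_ord. Qed.

Lemma mesh_ok_is_hexahedron i : is_hexahedron (@hexas_of n ts i).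
Proof. exact/is_hexahedron_ok/mesh_ok_hexahedron. Qed.

Lemma mesh_okP : (0 < n)%N -> hex_mesh (@hexas_of n ts) (mesh_body (@hexas_of n ts))°.
Proof.
move=> n0; have pairP (i j : 'I_n) : i != j ->
    cell (hexas_of ts i) `&` cell (hexas_of ts j) = set0 /\
    conforming (hexas_of ts i) (hexas_of ts j).
  move=> ij; apply: (@pair_okP cands); try exact: mesh_ok_hexahedron.
  case/and3P: ok => _ /allP/(_ i) + _; rewrite mem_iota ltn_ord => /(_ isT).
  move=> /allP/(_ j); rewrite mem_iota ltn_ord => /(_ isT).
  by rewrite val_eqE (negbTE ij).
apply: hex_mesh_body => //; first exact: mesh_ok_is_hexahedron.
- move=> i i0; case/and3P: ok => _ _ /allP/(_ i).
  rewrite mem_iota ltn_ord => /(_ isT); rewrite gtn_eqF //=.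
  move=> /hasP[j]; rewrite mem_iota add0n /= => ji link.
  have jn : (j < n)%N by apply: ltn_trans (ltn_ord i).
  exists (Ordinal jn) => //; apply: link_okP => //; first exact: mesh_ok_hexahedron.
  exact: (mesh_ok_hexahedron (Ordinal jn)).
- by move=> i j /pairP[].
- by move=> i j /pairP[].
Qed.

End MeshOk.
End Tables.

(** * Certificates for the star-shaped body and for reversing chains *)

Definition star_ok n (ts : nat -> table) : bool :=
  all (fun i => all (fun d => all (fun b => (0 <= (facet_normal (ts i) d b).2) ||
    has (fun j => sub_points (ts i) (ts j) (fun z => axis d z == b) predT)
      (iota 0 i)) signs) axes) (iota 0 n).

(** The origin is to lie in the relative interior of a facet between the two cells: offset 0 for
    this facet, positive offsets for the others. *)
Definition origin_ok (t u : table) : bool :=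
  has (fun d => has (fun b => has (fun e => has (fun b' =>
    let ac := facet_normal t d b in
    [&& ac.2 == 0, facet_ok u e b' (oppp ac.1) 0,
      all (fun d1 => all (fun b1 =>
        ((d1, b1) == (d, b)) || (0 < (facet_normal t d1 b1).2)) signs) axes &
      all (fun d1 => all (fun b1 =>
        ((d1, b1) == (e, b')) || (0 < (facet_normal u d1 b1).2)) signs) axes])
    signs) axes) signs) axes.

Definition edge_ok (t : table) d (u : table) e s : bool :=
  has (fun z => has (fun z' =>
    (t (relabel d z false) == u (relabel e z' s)) &&
    (t (relabel d z true) == u (relabel e z' (~~ s)))) labels) labels.

Fixpoint chain_ok (ts : nat -> table) i d (l : seq (nat * nat * bool)) : bool :=
  if l is (j, e, s) :: l' then edge_ok (ts i) d (ts j) e s && chain_ok ts j e l'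
  else true.

(** An entry [(j, e, s)] names a cell, one of its classes and whether the direction flips on
    entering it. The chain has to close up with an odd number of flips. *)
Definition moebius_ok n (ts : nat -> table) i d (l : seq (nat * nat * bool)) : bool :=
  [&& all (fun p => (p.1.1 < n)%N && (p.1.2 < 3)%N) ((i, d, false) :: l),
    chain_ok ts i d l, (last (i, d, false) l).1 == (i, d) &
    foldr (fun p s => p.2 (+) s) false l].

Section StarTables.
Variable R : realType.

Lemma vertex_of_relabel (d : 'I_3) z b :
  vertex_of (relabel d z b) = setc (vertex_of z) d b.
Proof.
apply/ffunP => e; rewrite !ffunE.
by case: d e z => -[|[|[|//]]] ? [[|[|[|//]]] ?] [[z0 z1] z2].
Qed.

Lemma zero_interior t u : hexahedron_ok t -> hexahedron_ok u -> origin_ok t u ->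
  (convex_hull (range (@hexa_of R t)) `|` convex_hull (range (hexa_of R u)))° 0.
Proof.
move=> ht hu /hasP[d d3 /hasP[b _ /hasP[e e3 /hasP[b' _]]]] /and4P[/eqP c0 fu ct cu].
have lt3 k : k \in axes -> (k < 3)%N by rewrite !inE => /or3P[] /eqP->.
pose d' := Ordinal (lt3 _ d3); pose e' := Ordinal (lt3 _ e3).
have lf0 (l : 'cV[R]_3) : lf l 0 = 0 by rewrite /lf mul0mx mxE.
have pos (v : table) d0 b0 :
    all (fun d1 => all (fun b1 => ((d1, b1) == (d0, b0)) ||
      (0 < (facet_normal v d1 b1).2)) signs) axes ->
    forall (d1 : 'I_3) b1, (val d1, b1) != (d0, b0) -> 0 < offset R v d1 b1.
  move=> /allP + d1 b1 => /(_ _ (mem_axes d1))/allP/(_ _ (mem_signs b1)).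
  by move=> /orP[/eqP->|]; rewrite ?eqxx // ltr0z.
have [] // := @facet_point_interior R (hexa_of R t) (hexa_of R u)
  (normal R t) (override_plane (normal R u) e' b' (- normal R t d' b))
  (offset R t) (override_plane (offset R u) e' b' (- offset R t d' b)) d' e' b b' 0.
- by move=> d1 b1; exact: hexahedron_okP.
- move=> d1 b1; rewrite /override_plane; case: ifP => [/andP[/eqP-> /eqP->]|_].
    rewrite /normal -covec_opp /offset c0 mulr0z oppr0 -(mulr0z 1).
    exact: facet_okP.
  exact: hexahedron_okP.
- by rewrite /override_plane !eqxx.
- by rewrite /override_plane !eqxx.
- by rewrite lf0 /offset c0.
- by move=> d1 b1 db; rewrite lf0; apply: (pos _ d b).
- move=> d1 b1 db; rewrite lf0 /override_plane ifN; first exact: (pos _ e b').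
  by apply: contraNN db => /andP[/eqP-> /eqP->].
Qed.

(** The offset of a facet is nonnegative exactly when the origin lies in its half-space; the
    remaining facets have to be covered by cells of smaller index. *)
Lemma star_okP n cands ts : mesh_ok n cands ts -> star_ok n ts -> (0 < n)%N ->
  star_shaped 0 (mesh_body (@hexas_of R n ts)).
Proof.
move=> mok sok n0.
apply: (@star_shaped_mesh_body _ _ _ (fun i => normal R (ts i))
  (fun i => offset R (ts i))) => // i d b.
  exact/hexahedron_okP/(mesh_ok_hexahedron mok).
move: sok => /allP/(_ (val i)); rewrite mem_iota ltn_ord => /(_ isT).
move=> /allP/(_ _ (mem_axes d))/allP/(_ _ (mem_signs b)) /orP[c0|/hasP[j]].
  by left; rewrite ler0z.
rewrite mem_iota add0n /= => ji ok; right.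
have jn : (j < n)%N by apply: ltn_trans (ltn_ord i).
exists (Ordinal jn) => // x xd.
have sub : @hexa_of R (ts i) @` [set x : cube_vertex | x d = b] `<=`
    range (hexa_of R (ts j)).
  by apply: (sub_pointsP ok) => // y yd; rewrite axis_label; apply/eqP.
by have [y _ yx] := sub _ (ex_intro2 _ _ x xd erefl); exists y.
Qed.

Lemma edge_okP n (ts : nat -> table) o (i j : 'I_n) (d e : 'I_3) s :
  edge_orientation (@hexas_of R n ts) o -> consistent (@hexas_of R n ts) o ->
  edge_ok (ts i) d (ts j) e s ->
  class_direction (@hexas_of R n ts) o i d =
  s (+) class_direction (@hexas_of R n ts) o j e.
Proof.
move=> oo co /hasP[z _ /hasP[z' _ /andP[/eqP tu0 /eqP tu1]]].
apply: (class_direction_shared oo co (x := vertex_of z) (y := vertex_of z'));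
  by rewrite /hexas_of /hexa_of -!vertex_of_relabel !vertex_ofK ?tu0 ?tu1.
Qed.

Lemma moebius_okP n ts i d l : moebius_ok n ts i d l ->
  ~ consistently_orientable (@hexas_of R n ts).
Proof.
move=> /and4P[/andP[/andP[/= ni d3] nl] ok /eqP il tw] [dir [oo co]].
(* The chain consists of plain numbers; [false] is a dummy value outside their ranges. *)
pose cd k e := if insub k is Some k' then
  if insub e is Some e' then class_direction (@hexas_of R n ts) dir k' e'
  else false else false.
suff : cd i d = foldr (fun p s => p.2 (+) s) false l (+) cd i d.
  by rewrite tw; case: (cd i d).
suff {1}-> : cd i d = foldr (fun p s => p.2 (+) s) false l (+)
    cd (last (i, d, false) l).1.1 (last (i, d, false) l).1.2 by rewrite il.
elim: l i d ni d3 nl ok {il tw} => [|[[j e] s] l IHl] i d ni d3 /=; first by [].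
move=> /andP[/andP[/= nj e3] nl] /andP[ij ok].
have lastE q q' : q.1 = q'.1 -> (last q l).1 = (last q' l).1 :> nat * nat.
  by move=> qq; case: (l) => [|? ?].
rewrite (lastE (j, e, s) (j, e, false) erefl) -addbA -IHl //.
rewrite /cd !insubT /=.
exact: (edge_okP (i := Ordinal ni) (j := Ordinal nj) (d := Ordinal d3) (e := Ordinal e3)).
Qed.

End StarTables.

(** * Fourteen hexahedra *)

(* [q] lists the corners in the plane of the first and third coordinates; the
   second axis of the cell runs from the graph of [front] to that of [back]. *)
Definition prism (q : seq (int * int)) (front back : int * int -> int) : table :=
  fun z => let p := nth (0, 0) q (z.1.1 + 2 * z.2)%N in
    (p.1, if z.1.2 then back p else front p, p.2).

Definition bent_slab q : table :=
  prism q (fun p => if p.1 == (-4)%Z then 1%Z else if p.1 == (-6)%Z then 3%Z else 0%Z)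
    (fun=> 4%Z).
Definition flat_slab q : table := prism q (fun=> (-1)%Z) (fun=> 0%Z).

(* Cell 1 and cell 2 above it are flanked by cells 3, 5 and 4, 6.  In the back
   slab cells 1, 7, 8, 5 wind around cell 3; in the front slab cells 0, 11, 12,
   10 wind around cell 9, which lies in front of cell 4.  The sheet through
   these two rings meets itself in cell 2 with opposite directions.  The front
   faces of cells 3, 5, 7, 8 are bent backwards to keep cell 7 away from cell
   11.  Cell 13 only serves to make the number of cells 14. *)
Definition cells14 (i : nat) : table :=
  let m := [:: (-2, -2); (2, -2); (-2, 2); (2, 2)]%Z in
  let q := [:: (2, -2); (4, -4); (2, 2); (4, 2)]%Z in
  let b := [:: (2, 2); (4, 2); (4, 4); (6, 4)]%Z in
  nth (flat_slab m)
  [:: flat_slab m;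
      bent_slab m;
      bent_slab [:: (-2, 2); (2, 2); (-1, 4); (4, 4)]%Z;
      bent_slab [:: (-4, -4); (-2, -2); (-4, 2); (-2, 2)]%Z;
      bent_slab q;
      bent_slab [:: (-4, 2); (-2, 2); (-6, 6); (-1, 4)]%Z;
      bent_slab b;
      bent_slab [:: (-6, -8); (2, -2); (-4, -4); (-2, -2)]%Z;
      bent_slab [:: (-6, -8); (-4, -4); (-6, 6); (-4, 2)]%Z;
      flat_slab q;
      flat_slab b;
      flat_slab [:: (-2, -2); (6, -8); (2, -2); (4, -4)]%Z;
      flat_slab [:: (4, -4); (6, -8); (4, 2); (6, 4)]%Z;
      prism m (fun=> 4%Z) (fun=> 5%Z)] i.

Definition mesh14 : nat -> table := tabulate 14 cells14.

(** Together with their opposites, these directions suffice to separate every pair of the 14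
    cells. *)
Definition normals14 : seq point :=
  [:: (3, -1, 0); (0, 0, 1); (0, 3, 1); (2, 0, 1); (1, 0, 0); (1, 0, -1);
      (0, 1, 0); (1, -1, -1); (0, 1, -1); (2, -1, 1); (1, 1, 0); (2, 0, -1);
      (1, 1, 1); (1, 0, 1); (1, 1, -1); (1, 0, -2); (1, -1, -2)]%Z.

Lemma mesh14_ok : mesh_ok 14 (normals14 ++ map oppp normals14) mesh14.
Proof. by vm_compute. Qed.

Lemma mesh14_star_ok : star_ok 14 mesh14.
Proof. by vm_compute. Qed.

Lemma mesh14_origin_ok : origin_ok (mesh14 0) (mesh14 1).
Proof. by vm_compute. Qed.

(** The chain follows the sheet through cells 2, 5, 8, 7 of the back slab, enters the front slab at
    the edge between [(-2, 0, -2)] and [(2, 0, -2)], passes cells 11 and 12, and returns to the back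
    slab in cell 6 at the edge between [(4, 0, 2)] and [(6, 0, 4)]. Three of its seven passages
    reverse the direction. *)
Lemma mesh14_moebius_ok : moebius_ok 14 mesh14 2 2
  [:: (5, 2, false); (8, 0, true); (7, 2, false); (11, 2, true); (12, 0, true);
      (6, 2, false); (2, 2, false)]%N.
Proof. by vm_compute. Qed.

Theorem nonorientable_ball (R : realType) :
  exists (T : hexas R 14) (Omega : set 'rV[R]_3),
    [/\ hex_mesh T Omega, simply_connected Omega, without_holes Omega &
        ~ consistently_orientable T].
Proof.
have mok := mesh14_ok.
pose T := @hexas_of R 14 mesh14; exists T, (mesh_body T)°.
have hT i : is_hexahedron (T i) by exact: (mesh_ok_is_hexahedron R mok).
have stU : star_shaped 0 (mesh_body T).
  exact: star_okP mok mesh14_star_ok _.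
(* The origin is the centre of the square shared by cells 0 and 1. *)
have U0 : (mesh_body T)° 0.
  have := zero_interior R (mesh_ok_hexahedron mok (Ordinal (isT : (0 < 14)%N)))
    (mesh_ok_hexahedron mok (Ordinal (isT : (1 < 14)%N))) mesh14_origin_ok.
  by apply: interiorS => x [Tx|Tx]; [exists ord0|exists (Ordinal (isT : (1 < 14)%N))].
have stO : star_shaped 0 (mesh_body T)° by exact: interior_star_shaped.
split.
- exact: mesh_okP mok _.
- exact: star_shaped_simply_connected stO.
- split.
    rewrite (closure_mesh_body_interior hT).
    exact: star_shaped_simply_connected stU.
  exact: star_shaped_complement_connected (@mesh_body_interior_bounded R 14 T) stO.
- exact: moebius_okP mesh14_moebius_ok.
Qed.

(** * The solid torus as a quotient of a cube *)

Section Quotient.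
Variables (X U V : topologicalType) (K : set X).
Hypotheses (cK : compact K).

(** The preimage of a closed set under [h] is the image under [f] of a compact part of [K], hence
    closed. *)
Lemma quotient_map_continuous (f : X -> U) (g : X -> V) (h : U -> V) :
  hausdorff_space U -> continuous f -> continuous g ->
  (forall x, K x -> h (f x) = g x) -> {within f @` K, continuous h}.
Proof.
move=> hU cf cg hfg; apply/continuous_closedP => C cC.
apply/closed_subspaceP.
have cKC : compact (K `&` g @^-1` C).
  by apply: compact_closedI => //; move/continuous_closedP: cg; exact.
exists (f @` (K `&` g @^-1` C)).
  apply: compact_closed => //.
  by apply: continuous_compact cKC; exact: continuous_subspaceT.
apply/seteqP; split=> u.
  case=> -[x [Kx gx] <-] fu; split=> //.
  by change (C (h (f x))); rewrite hfg.
case=> hu [x Kx xu]; split; exists x => //; split=> //.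
by change (C (g x)); rewrite -hfg // xu.
Qed.

End Quotient.

(** Both images are quotients of [K] by the same relation. The sections [s] and [t] are arbitrary
    choices; only the composites [g \o s] and [f \o t] are continuous, as maps induced on
    quotients. *)
Lemma homeomorphic_images (X U V : topologicalType) (K : set X)
    (f : X -> U) (g : X -> V) :
  compact K -> K !=set0 -> hausdorff_space U -> hausdorff_space V ->
  continuous f -> continuous g ->
  (forall x y, K x -> K y -> f x = f y <-> g x = g y) ->
  homeomorphic (f @` K) (g @` K).
Proof.
move=> cK [x0 Kx0] hU hV cf cg fg.
have sect (W : Type) (k : X -> W) :
    exists s : W -> X, forall x, K x -> K (s (k x)) /\ k (s (k x)) = k x.
  have /choice[s sP] : forall w : W, exists x, (k @` K) w -> K x /\ k x = w.
    move=> w; have [[x Kx kx]|nw] := pselect ((k @` K) w); first by exists x.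
    by exists x0.
  by exists s => x Kx; apply: sP; exists x.
have [s sP] := sect U f; have [t tP] := sect V g.
have hE x : K x -> g (s (f x)) = g x.
  by move=> Kx; have [Ks fs] := sP x Kx; apply/fg.
have kE x : K x -> f (t (g x)) = f x.
  by move=> Kx; have [Kt gt] := tP x Kx; apply/fg.
exists (g \o s), (f \o t); split.
- exact: (quotient_map_continuous cK hU cf cg).
- exact: (quotient_map_continuous cK hV cg cf).
- move=> _ [x Kx <-] /=; rewrite hE // kE //; split=> //; by exists x.
- move=> _ [x Kx <-] /=; rewrite kE // hE //; split=> //; by exists x.
Qed.

(** * The circle, rotations, and a map from the square onto the disc *)

Section Circle.
Variable R : realType.
Implicit Types (a b x y u v : R) (p q : R * R).

(** Equal points give [cos (b - a) = 1], so the sine of half the difference vanishes, and that half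
    lies between 0 and [pi]. *)
Lemma circle_inj a b : 0 <= a <= pi *+ 2 -> 0 <= b <= pi *+ 2 ->
  cos a = cos b -> sin a = sin b ->
  [\/ a = b, a = 0 /\ b = pi *+ 2 | a = pi *+ 2 /\ b = 0].
Proof.
wlog ab : a b / a <= b.
  move=> H aI bI cc ss; have [ab|/ltW ba] := leP a b; first exact: H.
  by have [] := H b a ba bI aI (esym cc) (esym ss) => [->|[]|[]];
    [constructor 1|constructor 3|constructor 2].
move=> /andP[a0 a2] /andP[b0 b2] cc ss.
pose h := (b - a) / 2.
have hE : h *+ 2 = b - a by rewrite /h -mulr_natr divfK.
have : cos (h *+ 2) = 1.
  rewrite hE cosB cc ss -!expr2; exact: cos2Dsin2.
rewrite cos_mulr2n cos2sin2 => sh.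
have {}sh : sin h = 0.
  apply/eqP; rewrite -sqrf_eq0; apply/eqP; move: sh; lra.
have [h0|h0] := leP h 0.
  constructor 1; apply/eqP; rewrite eq_le ab /=; move: h0; rewrite /h; lra.
have hp : pi <= h.
  by rewrite leNgt; apply/negP => hp; have := @sin_gt0_pi _ h; rewrite h0 hp sh ltxx => /(_ isT).
constructor 2; move: hp hE a2 b2; rewrite !mulr2n => *; split; lra.
Qed.

Lemma circle_surj x y : x ^+ 2 + y ^+ 2 = 1 ->
  exists a, [/\ 0 <= a <= pi *+ 2, cos a = x & sin a = y].
Proof.
move=> xy; have x1 : -1 <= x <= 1 by apply/andP; split; nra.
have [/andP[c0 cp] cx] := acos_def x1.
have sy : sin (acos x) = `|y|.
  by rewrite sin_acos // -xy addrAC subrr add0r sqrtr_sqr.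
have p0 : 0 <= pi :> R by exact: pi_ge0.
have [y0|y0] := leP 0 y.
  exists (acos x); split=> //; last by rewrite sy ger0_norm.
  by rewrite c0 /= mulr2n; lra.
exists (pi *+ 2 - acos x); split.
- by rewrite mulr2n; apply/andP; split; lra.
- by rewrite cosB cos2pi sin2pi mul1r mul0r addr0.
- by rewrite sinB cos2pi sin2pi mul1r mul0r sub0r sy ltr0_norm ?opprK.
Qed.

Definition quarter p : R * R := (- p.2, p.1).
Definition rotation a p : R * R :=
  (cos a * p.1 - sin a * p.2, sin a * p.1 + cos a * p.2).

Lemma rotation_quarter k p :
  rotation (k%:R * (pi / 2)) p = iter k quarter p.
Proof.
elim: k => [|k IHk]; last first.
  rewrite iterS -IHk /rotation /quarter -natr1 mulrDl mul1r cosDpihalf sinDpihalf /=.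
  by congr pair; ring.
by rewrite mul0r /rotation cos0 sin0 !mul1r !mul0r subr0 add0r; case: p.
Qed.

Lemma rotationK a : cancel (rotation (- a)) (rotation a).
Proof.
move=> [x y]; rewrite /rotation cosN sinN /=.
have cs := cos2Dsin2 a; congr pair.
  transitivity ((cos a ^+ 2 + sin a ^+ 2) * x); first by ring.
  by rewrite cs mul1r.
transitivity ((cos a ^+ 2 + sin a ^+ 2) * y); first by ring.
by rewrite cs mul1r.
Qed.

Lemma rotation_inj a : injective (rotation a).
Proof. by apply: (can_inj (g := rotation (- a))) => p; rewrite -{2}[a]opprK rotationK. Qed.

Lemma rotation_norm a p :
  (rotation a p).1 ^+ 2 + (rotation a p).2 ^+ 2 = p.1 ^+ 2 + p.2 ^+ 2.
Proof.
rewrite /rotation /=; transitivity ((cos a ^+ 2 + sin a ^+ 2) * (p.1 ^+ 2 + p.2 ^+ 2)).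
  by ring.
by rewrite cos2Dsin2 mul1r.
Qed.

(** The elliptical grid mapping of the square onto the disc. It commutes with quarter turns, as the
    identification of the ends requires, and 1 minus the squared norm of the image of [(u, v)] is
    [(1 - u ^+ 2) * (1 - v ^+ 2)]. *)
Definition disc_map p : R * R :=
  (p.1 * Num.sqrt (1 - p.2 ^+ 2 / 2), p.2 * Num.sqrt (1 - p.1 ^+ 2 / 2)).

Lemma disc_map_quarter k p : disc_map (iter k quarter p) = iter k quarter (disc_map p).
Proof.
elim: k => //= k <-; rewrite /disc_map /quarter /= sqrrN.
by rewrite mulNr.
Qed.

Lemma sqr_itv u : -1 <= u <= 1 -> 0 <= u ^+ 2 <= 1.
Proof. by move=> /andP[u0 u1]; apply/andP; split; nra. Qed.

Lemma disc_map_sqr p : -1 <= p.1 <= 1 -> -1 <= p.2 <= 1 ->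
  (disc_map p).1 ^+ 2 = p.1 ^+ 2 * (1 - p.2 ^+ 2 / 2) /\
  (disc_map p).2 ^+ 2 = p.2 ^+ 2 * (1 - p.1 ^+ 2 / 2).
Proof.
move=> /sqr_itv/andP[u0 u1] /sqr_itv/andP[v0 v1].
by rewrite /disc_map /= !exprMn !sqr_sqrtr //; lra.
Qed.

Lemma disc_map_le1 p : -1 <= p.1 <= 1 -> -1 <= p.2 <= 1 ->
  (disc_map p).1 ^+ 2 + (disc_map p).2 ^+ 2 <= 1.
Proof.
move=> pu pv; have [-> ->] := disc_map_sqr pu pv.
move: pu pv => /sqr_itv/andP[u0 u1] /sqr_itv/andP[v0 v1].
have : 0 <= (1 - p.1 ^+ 2) * (1 - p.2 ^+ 2) by rewrite mulr_ge0 // subr_ge0.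
by lra.
Qed.

Lemma eqr_sqr_sign x y s t : 0 < s -> 0 < t -> x ^+ 2 = y ^+ 2 ->
  x * s = y * t -> x = y.
Proof.
move=> s0 t0 /eqP; rewrite eqf_sqr => /orP[/eqP//|/eqP->].
move=> yst; have : y * (s + t) = 0 by rewrite mulrDr -yst mulNr addrN.
move/eqP; rewrite mulf_eq0 => /orP[/eqP->|]; first by rewrite oppr0.
by rewrite gt_eqF // addr_gt0.
Qed.

Lemma disc_map_inj p q : -1 <= p.1 <= 1 -> -1 <= p.2 <= 1 ->
  -1 <= q.1 <= 1 -> -1 <= q.2 <= 1 -> disc_map p = disc_map q -> p = q.
Proof.
move=> pu pv qu qv pq.
have [p1 p2] := disc_map_sqr pu pv; have [q1 q2] := disc_map_sqr qu qv.
move: (sqr_itv pu) (sqr_itv pv) (sqr_itv qu) (sqr_itv qv).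
move=> /andP[a0 a1] /andP[b0 b1] /andP[c0 c1] /andP[d0 d1].
have e1 : p.1 ^+ 2 * (1 - p.2 ^+ 2 / 2) = q.1 ^+ 2 * (1 - q.2 ^+ 2 / 2).
  by rewrite -p1 -q1 pq.
have e2 : p.2 ^+ 2 * (1 - p.1 ^+ 2 / 2) = q.2 ^+ 2 * (1 - q.1 ^+ 2 / 2).
  by rewrite -p2 -q2 pq.
(* The mixed terms cancel in the difference of the two equations. *)
have diff : p.1 ^+ 2 - q.1 ^+ 2 = p.2 ^+ 2 - q.2 ^+ 2 by lra.
have sq1 : p.1 ^+ 2 = q.1 ^+ 2.
  set a := p.1 ^+ 2 in a0 a1 e1 e2 diff *; set b := p.2 ^+ 2 in b0 b1 e1 e2 diff.
  set c := q.1 ^+ 2 in c0 c1 e1 e2 diff *; set d := q.2 ^+ 2 in d0 d1 e1 e2 diff.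
  have : (a - c) * ((1 - b) + (1 - c)) = 0.
    have -> : b = d + (a - c) by lra.
    have bE : b = d + (a - c) by lra.
    move: e1 e2; rewrite bE; lra.
  move/eqP; rewrite mulf_eq0 => /orP[|/eqP bc]; first by rewrite subr_eq0 => /eqP.
  (* Here [b = c = 1], and then [a] and [d] can be at most 1 only if [a = c]. *)
  lra.
have sq2 : p.2 ^+ 2 = q.2 ^+ 2 by lra.
have pos t : 0 <= t <= 1 -> 0 < Num.sqrt (1 - t / 2).
  by move=> /andP[t0 t1]; rewrite sqrtr_gt0; lra.
have [f1 f2] : (disc_map p).1 = (disc_map q).1 /\ (disc_map p).2 = (disc_map q).2.
  by rewrite pq.
move: p q pu pv qu qv pq p1 p2 q1 q2 a0 a1 b0 b1 c0 c1 d0 d1 e1 e2 diff sq1 sq2 f1 f2.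
move=> [u v] [w z] /= *; congr pair.
  by apply: (@eqr_sqr_sign _ _ (Num.sqrt (1 - v ^+ 2 / 2)) (Num.sqrt (1 - z ^+ 2 / 2)));
    rewrite // pos //; apply/andP.
by apply: (@eqr_sqr_sign _ _ (Num.sqrt (1 - u ^+ 2 / 2)) (Num.sqrt (1 - w ^+ 2 / 2)));
  rewrite // pos //; apply/andP.
Qed.

Lemma sqrt_signed x a : 0 <= a -> exists u, u ^+ 2 = a /\ 0 <= u * x.
Proof.
move=> a0; have [x0|x0] := leP 0 x.
  by exists (Num.sqrt a); rewrite sqr_sqrtr // mulr_ge0 // sqrtr_ge0.
exists (- Num.sqrt a); rewrite sqrrN sqr_sqrtr //; split=> //.
by rewrite mulNr -mulrN mulr_ge0 ?sqrtr_ge0 // oppr_ge0 ltW.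
Qed.

Lemma disc_map_surj q : q.1 ^+ 2 + q.2 ^+ 2 <= 1 ->
  exists p, [/\ -1 <= p.1 <= 1, -1 <= p.2 <= 1 & disc_map p = q].
Proof.
case: q => x y /= xy1.
have x0 := sqr_ge0 x; have y0 := sqr_ge0 y.
set X := x ^+ 2 in xy1 x0; set Y := y ^+ 2 in xy1 y0.
pose D := X - Y; pose S := X + Y.
(* The squares [a], [b] of the coordinates sought satisfy [a - b = D] and
   [(1 - a) * (1 - b) = 1 - S]; hence [g] is the sum of [1 - a] and [1 - b]. *)
pose g := Num.sqrt (D ^+ 2 + 4 * (1 - S)).
have g0 : 0 <= g by exact: sqrtr_ge0.
have S1 : 0 <= 4 * (1 - S) by rewrite mulr_ge0 // subr_ge0.
have gg : g ^+ 2 = D ^+ 2 + 4 * (1 - S) by rewrite sqr_sqrtr // addr_ge0 ?sqr_ge0.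
have sqr_le (z w : R) : 0 <= w -> z ^+ 2 <= w ^+ 2 -> z <= w.
  move=> w0; have [z0|z0] := leP 0 z; first by rewrite ler_sqr.
  by move=> _; exact: le_trans (ltW z0) w0.
have gD : D <= g by apply: sqr_le => //; rewrite gg lerDl.
have gND : - D <= g by apply: sqr_le => //; rewrite sqrrN gg lerDl.
have g2 : g <= 2 + D.
  apply: sqr_le; first by rewrite /D; lra.
  have e : (2 + D) ^+ 2 - (D ^+ 2 + 4 * (1 - S)) = 8 * X by rewrite /S /D; ring.
  by rewrite gg -subr_ge0 e mulr_ge0.
have g2' : g <= 2 - D.
  apply: sqr_le; first by rewrite /D; lra.
  have e : (2 - D) ^+ 2 - (D ^+ 2 + 4 * (1 - S)) = 8 * Y by rewrite /S /D; ring.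
  by rewrite gg -subr_ge0 e mulr_ge0.
pose a := 1 - (g - D) / 2; pose b := 1 - (g + D) / 2.
have a01 : 0 <= a <= 1 by rewrite /a; apply/andP; split; lra.
have b01 : 0 <= b <= 1 by rewrite /b; apply/andP; split; lra.
have aX : a * (1 - b / 2) = X by rewrite /a /b /D /S in gg *; nra.
have bY : b * (1 - a / 2) = Y by rewrite /a /b /D /S in gg *; nra.
have [u [ua ux]] : exists u, u ^+ 2 = a /\ 0 <= u * x.
  by apply: sqrt_signed; case/andP: a01.
have [v [vb vy]] : exists v, v ^+ 2 = b /\ 0 <= v * y.
  by apply: sqrt_signed; case/andP: b01.
have itv (w c : R) : w ^+ 2 = c -> 0 <= c <= 1 -> -1 <= w <= 1.
  by move=> <- /andP[_ w1]; apply/andP; split; nra.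
have uI := itv _ _ ua a01; have vI := itv _ _ vb b01.
exists (u, v); split=> //; rewrite /disc_map /=.
have sgn (w z c : R) : 0 <= w * z -> 0 <= c -> (w * c) ^+ 2 = z ^+ 2 -> w * c = z.
  move=> wz c0 /eqP; rewrite eqf_sqr => /orP[/eqP//|/eqP wcz].
  have : w * z * c = - z ^+ 2 by rewrite mulrAC wcz mulNr.
  have zz := sqr_ge0 z; move: (mulr_ge0 wz c0) => /[swap] -> /[!oppr_ge0] zz0.
  have /eqP : z ^+ 2 = 0 by apply/eqP; rewrite eq_le zz0.
  by rewrite sqrf_eq0 => /eqP z0; rewrite wcz z0 oppr0.
congr pair; apply: sgn => //; rewrite ?sqrtr_ge0 // exprMn sqr_sqrtr ?ua ?vb //.
- by rewrite subr_ge0; lra.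
- by rewrite subr_ge0; lra.
Qed.

Lemma disc_map_continuous : continuous disc_map.
Proof.
have cs : continuous (fun t : R => Num.sqrt (1 - t ^+ 2 / 2)).
  move=> t; apply: (@continuous_comp _ _ _ (fun t : R => 1 - t ^+ 2 / 2)); last exact: sqrt_continuous.
  apply: cvgB; first exact: cvg_cst.
  by apply: cvgM; [exact: exprn_continuous|exact: cvg_cst].
have c1 : continuous (fun p : R * R => Num.sqrt (1 - p.1 ^+ 2 / 2)).
  move=> p; apply: (@continuous_comp _ _ _ fst (fun t : R => Num.sqrt (1 - t ^+ 2 / 2))).
    exact: cvg_fst.
  exact: cs.
have c2 : continuous (fun p : R * R => Num.sqrt (1 - p.2 ^+ 2 / 2)).
  move=> p; apply: (@continuous_comp _ _ _ snd (fun t : R => Num.sqrt (1 - t ^+ 2 / 2))).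
    exact: cvg_snd.
  exact: cs.
have m1 : continuous (fun p : R * R => p.1 * Num.sqrt (1 - p.2 ^+ 2 / 2)).
  by move=> p; apply: cvgM; [exact: cvg_fst|exact: c2].
have m2 : continuous (fun p : R * R => p.2 * Num.sqrt (1 - p.1 ^+ 2 / 2)).
  by move=> p; apply: cvgM; [exact: cvg_snd|exact: c1].
by move=> p; exact: cvg_pair (m1 p) (m2 p).
Qed.

End Circle.

(** * Tubes *)

Section Tube.
Variables (R : realType) (n k : nat) (T : hexas R n).
Local Notation V := 'rV[R]_3.
Variables (c e f d : nat -> V) (al be ga : nat -> R).

Definition tube_section j (p : R * R) : V := c j + p.1 *: e j + p.2 *: f j.

Definition sign_of (b : bool) : R := if b then 1 else -1.

Hypothesis n0 : (0 < n)%N.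
Hypothesis TE : forall (i : 'I_n) x, T i x =
  tube_section (i + x string_axis) (sign_of (x 0), sign_of (x 1)).
(* Cell [j] is a prism in the direction [d j], cut off by two planes. *)
Hypothesis cS : forall j, (j < n)%N -> c j.+1 = c j + al j *: d j.
Hypothesis eS : forall j, (j < n)%N -> e j.+1 = e j + be j *: d j.
Hypothesis fS : forall j, (j < n)%N -> f j.+1 = f j + ga j *: d j.
Hypothesis height0 : forall j, (j < n)%N -> `|be j| + `|ga j| < al j.
(** Linear independence of [e j], [f j] and [d j], in a form that reads off the coordinates of a
    point one after the other. *)
Hypothesis frame : forall j, (j < n)%N -> exists lu lv ld : 'cV[R]_3,
  [/\ [/\ lf lu (e j) != 0, lf lu (f j) = 0 & lf lu (d j) = 0],
      [/\ lf lv (e j) = 0, lf lv (f j) != 0 & lf lv (d j) = 0] &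
      lf ld (d j) != 0].
Hypothesis wrap : forall p, tube_section n p = tube_section 0 (iter k (@quarter R) p).

Definition square (p : R * R) : Prop := -1 <= p.1 <= 1 /\ -1 <= p.2 <= 1.

Definition height j (p : R * R) : R := al j + p.1 * be j + p.2 * ga j.

Lemma height_gt0 j p : (j < n)%N -> square p -> 0 < height j p.
Proof.
have prod (w z : R) : -1 <= w <= 1 -> - `|z| <= w * z.
  move=> w1; rewrite lerNl -mulNr (le_trans (ler_norm _)) // normrM normrN.
  by rewrite ler_piMl // ler_norml.
move=> jn [/(prod _ (be j)) pb /(prod _ (ga j)) pg]; have := height0 jn.
rewrite /height; lra.
Qed.

Lemma tube_sectionS j p : (j < n)%N ->
  tube_section j.+1 p = tube_section j p + height j p *: d j.
Proof.
move=> jn; rewrite /tube_section cS // eS // fS // /height.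
by apply/rowP => i; rewrite !mxE; ring.
Qed.

Lemma tube_coordinates_inj j p q s t : (j < n)%N ->
  tube_section j p + s *: d j = tube_section j q + t *: d j -> p = q /\ s = t.
Proof.
move=> jn; have [lu [lv [ld [[ue uf ud] [ve vf vd] dd]]]] := frame jn.
move=> pq; have lpq l : lf l (tube_section j p + s *: d j) =
    lf l (tube_section j q + t *: d j) by rewrite pq.
have p1 : p.1 = q.1.
  have := lpq lu; rewrite /tube_section !lfD !lfZ uf ud !mulr0 !addr0.
  by move/addrI/(mulIf ue).
have p2 : p.2 = q.2.
  have := lpq lv; rewrite /tube_section !lfD !lfZ ve vd !mulr0 !addr0.
  by move/addrI/(mulIf vf).
have {}p1 : p = q by move: p q {pq lpq} p1 p2 => [? ?] [? ?] /= -> ->.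
split=> //; have := lpq ld; rewrite p1 lfD (lfD _ _ (t *: d j)) !lfZ.
by move/addrI/(mulIf dd).
Qed.

Definition tube_cell j (t : R) p : V :=
  t *: tube_section j.+1 p + (1 - t) *: tube_section j p.

Lemma tube_cellE j t p : (j < n)%N ->
  tube_cell j t p = tube_section j p + (t * height j p) *: d j.
Proof.
move=> jn; rewrite /tube_cell tube_sectionS // scalerDr scalerA addrAC -scalerDl.
by rewrite subrKC scale1r.
Qed.

Lemma tube_cell_inj j s t p q : (j < n)%N -> square p ->
  tube_cell j s p = tube_cell j t q -> s = t /\ p = q.
Proof.
move=> jn sp; rewrite !tube_cellE // => /(tube_coordinates_inj jn)[pq].
rewrite -pq => /(mulIf _) st; split=> //; apply: st.
by rewrite gt_eqF // height_gt0.
Qed.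

Lemma square_convex p q t : square p -> square q -> 0 <= t <= 1 ->
  square (t * p.1 + (1 - t) * q.1, t * p.2 + (1 - t) * q.2).
Proof.
move=> [/andP[? ?] /andP[? ?]] [/andP[? ?] /andP[? ?]] /andP[? ?].
by split; apply/andP; split=> /=; nra.
Qed.

Lemma tube_section_convex j p q t :
  t *: tube_section j p + (1 - t) *: tube_section j q =
  tube_section j (t * p.1 + (1 - t) * q.1, t * p.2 + (1 - t) * q.2).
Proof. by apply/rowP => i; rewrite !mxE /=; ring. Qed.

Lemma square_sign a b : square (sign_of a, sign_of b).
Proof. by split; case: a; case: b; apply/andP; split=> /=; lra. Qed.

Lemma hull_tube_section (A : set cube_vertex) (i : 'I_n) b :
  (forall x, A x -> x string_axis = b) ->
  convex_hull (T i @` A) `<=` [set tube_section (i + b) p | p in square].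
Proof.
move=> Ab; apply: convex_hull_min; last first.
  move=> _ [x Ax <-]; rewrite TE (Ab _ Ax).
  by exists (sign_of (x 0), sign_of (x 1)) => //; exact: square_sign.
apply/convex_segment => _ _ t [p sp <-] [q sq <-] t01.
rewrite tube_section_convex; eexists; last by [].
exact: square_convex.
Qed.

(** The points at heights between 0 and [height i p] above the section form a convex set because the
    height is affine in [p]. Conversely, bilinear interpolation of four vertices gives each end
    section, and segments between the two end sections fill the cell. *)
Lemma hull_tube_cell (i : 'I_n) : convex_hull (range (T i)) =
  [set tube_cell i q.1 q.2 | q in [set q : R * (R * R) | 0 <= q.1 <= 1 /\ square q.2]].
Proof.
have jn := ltn_ord i; apply/seteqP; split.
  pose S := [set y | exists p s, [/\ square p, 0 <= s <= height i p &
    y = tube_section i p + s *: d i]].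
  have : convex_hull (range (T i)) `<=` S.
    apply: convex_hull_min.
      apply/convex_segment => x y t [p [s [sp /andP[s0 s1] ->]]].
      move=> [q [r [sq /andP[r0 r1] ->]]] /[dup] t01 /andP[t0 t1].
      exists (t * p.1 + (1 - t) * q.1, t * p.2 + (1 - t) * q.2), (t * s + (1 - t) * r).
      split; first exact: square_convex.
        have t1' : 0 <= 1 - t by rewrite subr_ge0.
        rewrite addr_ge0 ?mulr_ge0 //=.
        apply: (@le_trans _ _ (t * height i p + (1 - t) * height i q)).
          by rewrite lerD // ler_wpM2l.
        by rewrite le_eqVlt; apply/orP; left; apply/eqP; rewrite /height /=; ring.
      rewrite -tube_section_convex; apply/rowP => j; rewrite !mxE; ring.
    move=> _ [x _ <-]; rewrite TE.
    have ss := square_sign (x 0) (x 1); have hh := height_gt0 jn ss.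
    exists (sign_of (x 0), sign_of (x 1)).
    case: (x string_axis).
      exists (height i (sign_of (x 0), sign_of (x 1))); split=> //.
        by rewrite lexx ltW.
      by rewrite addn1 tube_sectionS.
    by exists 0; rewrite addn0 scale0r addr0 lexx ltW.
  move=> H y /H[p [s [sp /andP[s0 s1] ->]]]; have hp := height_gt0 jn sp.
  exists (s / height i p, p) => /=; last by rewrite tube_cellE // divfK ?gt_eqF.
  split=> //; apply/andP; split; last by rewrite ler_pdivrMr // mul1r.
  by apply: divr_ge0 => //; exact: ltW.
move=> _ [[t p] /= [t01 sp] <-].
have /convex_segment hc := @convex_hull_convex R (range (T i)).
have [/andP[u0 u1] /andP[v0 v1]] := sp.
have sec (b : bool) : convex_hull (range (T i)) (tube_section (i + b) p).
  have ver (b0 b1 : bool) : convex_hull (range (T i))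
      (tube_section (i + b) (sign_of b0, sign_of b1)).
    apply: sub_convex_hull.
    exists [ffun a : 'I_3 => if a == 0 then b0 else if a == 1 then b1 else b] => //.
    by rewrite TE !ffunE.
  pose a1 := (1 + p.1) / 2; pose a2 := (1 + p.2) / 2.
  have a1I : 0 <= a1 <= 1 by rewrite /a1; apply/andP; split; lra.
  have a2I : 0 <= a2 <= 1 by rewrite /a2; apply/andP; split; lra.
  have := hc _ _ _ (hc _ _ _ (ver true true) (ver false true) a1I)
    (hc _ _ _ (ver true false) (ver false false) a1I) a2I.
  rewrite !tube_section_convex; congr (convex_hull _ (tube_section _ _)).
  by rewrite /= /a1 /a2; case: p {sp u0 u1 v0 v1 a1 a2 a1I a2I} => u v /=; congr pair; field.
have := hc _ _ _ (sec true) (sec false) t01.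
by rewrite addn1 addn0.
Qed.

(** Piecewise linear interpolation of the points [g j]: a summand is 0 before its side and the full
    step after it. As a single sum it is continuous without any gluing. *)
Definition polygonal (g : nat -> V) (s : R) : V :=
  g 0%N + \sum_(j < n) clamp (s - j%:R) *: (g j.+1 - g j).

Lemma polygonalE g (i : 'I_n) t : 0 <= t <= 1 ->
  polygonal g (i%:R + t) = t *: g i.+1 + (1 - t) *: g i.
Proof.
move=> t01; have [t0 t1] := andP t01.
have part m : (m <= n)%N -> \sum_(0 <= j < m) clamp (i%:R + t - j%:R) *: (g j.+1 - g j) =
    if (m <= i)%N then g m - g 0%N else t *: (g i.+1 - g i) + (g i - g 0%N).
  elim: m => [|m IHm] mn; first by rewrite big_geq //= subrr.
  rewrite big_nat_recr //= IHm; last exact: ltnW.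
  have [mi|im|mi] := ltngtP m i.
  - rewrite clamp_ge1 ?scale1r; first by apply/rowP => l; rewrite !mxE; ring.
    have : m.+1%:R <= i%:R :> R by rewrite ler_nat.
    by rewrite -natr1; lra.
  - rewrite clamp_le0 ?scale0r ?addr0 //.
    have : i.+1%:R <= m%:R :> R by rewrite ler_nat.
    by rewrite -natr1; lra.
  - by rewrite mi (addrAC i%:R) subrr add0r clamp_id // addrC.
rewrite /polygonal -(big_mkord xpredT (fun j => clamp (i%:R + t - j%:R) *: (g j.+1 - g j))).
rewrite part // leqNgt ltn_ord /=.
by apply/rowP => j; rewrite !mxE; ring.
Qed.

Lemma polygonal_continuous g : continuous (polygonal g).
Proof.
move=> s; apply: (@continuousD _ _ _ (fun=> g 0%N)); first exact: cst_continuous.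
apply: continuous_bigsum => j {}s.
apply: (@continuousZr_tmp _ _ _ (fun s : R => clamp (s - j%:R))).
apply: (@continuous_comp _ _ _ (fun s : R => s - j%:R)); last exact: clamp_continuous.
by apply: cvgB; [exact: cvg_id|exact: cvg_cst].
Qed.

Definition tube_map (q : R * (R * R)) : V :=
  polygonal c q.1 + q.2.1 *: polygonal e q.1 + q.2.2 *: polygonal f q.1.

Lemma tube_mapE (i : 'I_n) t p : 0 <= t <= 1 ->
  tube_map (i%:R + t, p) = tube_cell i t p.
Proof.
move=> t01; rewrite /tube_map !polygonalE // /tube_cell /tube_section.
by apply/rowP => j; rewrite !mxE /=; ring.
Qed.

Lemma tube_map_continuous : continuous tube_map.
Proof.
have cp g : continuous (fun q : R * (R * R) => polygonal g q.1).
  by move=> q; apply: (@continuous_comp _ _ _ fst);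
    [exact: cvg_fst|exact: polygonal_continuous].
move=> q; apply: (@continuousD _ _ _ (fun q : R * (R * R) =>
  polygonal c q.1 + q.2.1 *: polygonal e q.1)).
  apply: (@continuousD _ _ _ (fun q : R * (R * R) => polygonal c q.1)).
    exact: cp.
  apply: (@continuousZ _ _ _ (fun q : R * (R * R) => q.2.1)); last exact: cp.
  by apply: (@continuous_comp _ _ _ snd fst); [exact: cvg_snd|exact: cvg_fst].
apply: (@continuousZ _ _ _ (fun q : R * (R * R) => q.2.2)); last exact: cp.
by apply: (@continuous_comp _ _ _ snd snd); [exact: cvg_snd|exact: cvg_snd].
Qed.

(** The disc turns at constant speed, by [k] quarter turns over the whole length [n], so that the
    ends are identified as those of the tube are. *)
Definition torus_map (q : R * (R * R)) : (R * R) * (R * R) :=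
  ((cos (pi *+ 2 * (q.1 / n%:R)), sin (pi *+ 2 * (q.1 / n%:R))),
   rotation (k%:R * (pi / 2) * (q.1 / n%:R)) (disc_map q.2)).

Lemma torus_map_continuous : continuous torus_map.
Proof.
have cq (a : R) : continuous (fun q : R * (R * R) => a * (q.1 / n%:R)).
  move=> q; apply: cvgM; first exact: cvg_cst.
  by apply: cvgM; [exact: cvg_fst|exact: cvg_cst].
have cc (a : R) : continuous (fun q : R * (R * R) => cos (a * (q.1 / n%:R))).
  move=> q; apply: (@continuous_comp _ _ _ (fun q : R * (R * R) => a * (q.1 / n%:R)) cos).
    exact: cq.
  exact: continuous_cos.
have cs (a : R) : continuous (fun q : R * (R * R) => sin (a * (q.1 / n%:R))).
  move=> q; apply: (@continuous_comp _ _ _ (fun q : R * (R * R) => a * (q.1 / n%:R)) sin).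
    exact: cq.
  exact: continuous_sin.
have c1 : continuous (fun q : R * (R * R) => (disc_map q.2).1).
  move=> q; apply: (@continuous_comp _ _ _ (fun q : R * (R * R) => disc_map q.2) fst);
    last exact: cvg_fst.
  by apply: (@continuous_comp _ _ _ snd); [exact: cvg_snd|exact: disc_map_continuous].
have c2 : continuous (fun q : R * (R * R) => (disc_map q.2).2).
  move=> q; apply: (@continuous_comp _ _ _ (fun q : R * (R * R) => disc_map q.2) snd);
    last exact: cvg_snd.
  by apply: (@continuous_comp _ _ _ snd); [exact: cvg_snd|exact: disc_map_continuous].
pose th := k%:R * (pi / 2) : R.
have r1 : continuous (fun q : R * (R * R) => cos (th * (q.1 / n%:R)) * (disc_map q.2).1 -
    sin (th * (q.1 / n%:R)) * (disc_map q.2).2).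
  by move=> q; apply: cvgB; apply: cvgM; [exact: cc|exact: c1|exact: cs|exact: c2].
have r2 : continuous (fun q : R * (R * R) => sin (th * (q.1 / n%:R)) * (disc_map q.2).1 +
    cos (th * (q.1 / n%:R)) * (disc_map q.2).2).
  by move=> q; apply: cvgD; apply: cvgM; [exact: cs|exact: c1|exact: cc|exact: c2].
by move=> q; exact: cvg_pair (cvg_pair (cc _ q) (cs _ q)) (cvg_pair (r1 q) (r2 q)).
Qed.

Definition tube_domain : set (R * (R * R)) := `[0, n%:R] `*` (`[-1, 1] `*` `[-1, 1]).

Lemma tube_domainP q : tube_domain q <-> 0 <= q.1 <= n%:R /\ square q.2.
Proof. by rewrite /tube_domain /= !in_itv. Qed.

Lemma tube_domain_compact : compact tube_domain.
Proof. by do 2?apply: compact_setX; exact: segment_compact. Qed.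

Lemma segment_index m (s : R) : (0 < m)%N -> 0 <= s <= m%:R ->
  exists i : 'I_m, exists2 t, 0 <= t <= 1 & s = i%:R + t.
Proof.
elim: m => // m IHm _ /andP[s0 sm].
have [sm'|ms] := leP s m%:R; last first.
  exists ord_max, (s - m%:R); last by rewrite subrKC.
  by rewrite subr_ge0 (ltW ms) lerBlDl natr1.
have [m0|m0] := posnP m.
  have m0R : m%:R = 0 :> R by rewrite m0.
  exists ord_max, s; last by rewrite /= m0R add0r.
  by rewrite s0 (le_trans sm') // m0R ler01.
have [|i [t t01 sE]] := IHm m0; first by rewrite s0.
by exists (widen_ord (leqnSn m) i), t.
Qed.

(* Both maps identify exactly the two ends of the cube, through [k] quarter
   turns. *)
Definition same_fibre (q q' : R * (R * R)) : Prop :=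
  [\/ q = q',
      [/\ q.1 = n%:R, q'.1 = 0 & q'.2 = iter k (@quarter R) q.2] |
      [/\ q.1 = 0, q'.1 = n%:R & q.2 = iter k (@quarter R) q'.2]].

Lemma same_fibre_sym q q' : same_fibre q q' -> same_fibre q' q.
Proof. by case=> [->|[? ? ?]|[? ? ?]]; [constructor 1|constructor 3|constructor 2]. Qed.

Let natn0 : n%:R != 0 :> R.
Proof. by rewrite pnatr_eq0 -lt0n. Qed.

Lemma tube_map_end p : tube_map (n%:R, p) = tube_section n p.
Proof.
have nn : (n.-1 < n)%N by rewrite prednK.
have -> : n%:R = (Ordinal nn)%:R + 1 :> R by rewrite natr1 /= prednK.
rewrite tube_mapE ?ler01 ?lexx // /tube_cell scale1r subrr scale0r addr0 /=.
by rewrite prednK.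
Qed.

Lemma tube_map_start p : tube_map (0, p) = tube_section 0 p.
Proof.
have := @tube_mapE (Ordinal n0) 0 p; rewrite addr0 => ->; last by rewrite lexx ler01.
by rewrite /tube_cell scale0r add0r subr0 scale1r.
Qed.

Lemma torus_map_end p : torus_map (n%:R, p) = torus_map (0, iter k (@quarter R) p).
Proof.
rewrite /torus_map /= divff // mul0r !mulr0 !mulr1 cos2pi sin2pi cos0 sin0.
rewrite disc_map_quarter -rotation_quarter; congr (_, _).
by rewrite /rotation cos0 sin0 /= !mul1r !mul0r subr0 add0r.
Qed.

Lemma same_fibre_torus q q' : tube_domain q -> tube_domain q' ->
  torus_map q = torus_map q' <-> same_fibre q q'.
Proof.
move=> /tube_domainP[sq pq] /tube_domainP[sq' pq']; split; last first.
  case=> [->//|[q1 q1' q2]|[q1 q1' q2]].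
    rewrite (surjective_pairing q) (surjective_pairing q') q1 q1' q2.
    exact: torus_map_end.
  rewrite (surjective_pairing q) (surjective_pairing q') q1 q1' q2.
  by rewrite torus_map_end.
have pp : 0 < pi *+ 2 :> R by rewrite mulrn_wgt0 // pi_gt0.
have ang (s : R) : 0 <= s <= n%:R -> 0 <= pi *+ 2 * (s / n%:R) <= pi *+ 2.
  move=> /andP[s0 sn]; rewrite mulr_ge0 ?(ltW pp) ?divr_ge0 //=.
  by rewrite ger_pMr // ler_pdivrMr ?mul1r // ltr0n.
move=> E; have E1 : cos (pi *+ 2 * (q.1 / n%:R)) = cos (pi *+ 2 * (q'.1 / n%:R)).
  by case: E.
have E2 : sin (pi *+ 2 * (q.1 / n%:R)) = sin (pi *+ 2 * (q'.1 / n%:R)) by case: E.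
have E3 := congr1 snd E.
have dinj r r' : square r -> square r' -> disc_map r = disc_map r' -> r = r'.
  by move=> [? ?] [? ?]; exact: disc_map_inj.
have sqk r : square r -> square (iter k (@quarter R) r).
  elim: (k) => //= m IHm /IHm [/andP[a0 a1] /andP[b0 b1]].
  by split=> /=; apply/andP; split; lra.
have at0 (s : R) : pi *+ 2 * (s / n%:R) = 0 -> s = 0.
  move/eqP; rewrite mulf_eq0 gt_eqF //= mulf_eq0 invr_eq0 (negbTE natn0) orbF.
  by move/eqP.
have atn (s : R) : pi *+ 2 * (s / n%:R) = pi *+ 2 -> s = n%:R.
  move=> h; apply: (mulIf (invr_neq0 natn0)); rewrite divff //.
  by apply: (mulfI (lt0r_neq0 pp)); rewrite h mulr1.
case: (circle_inj (ang _ sq) (ang _ sq') E1 E2).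
- move/(mulfI (lt0r_neq0 pp))/(mulIf (invr_neq0 natn0)) => q1.
  constructor 1; rewrite (surjective_pairing q) (surjective_pairing q') q1.
  congr pair; move: E3; rewrite /torus_map /= q1 => /rotation_inj.
  exact: dinj.
- move=> [/at0 q1 /atn q1']; constructor 3; split=> //.
  move: E; rewrite (surjective_pairing q) (surjective_pairing q') q1 q1'.
  rewrite torus_map_end => /(congr1 snd)/rotation_inj.
  by apply: dinj => //; exact: sqk.
- move=> [/atn q1 /at0 q1']; constructor 2; split=> //.
  move: E; rewrite (surjective_pairing q) (surjective_pairing q') q1 q1'.
  rewrite torus_map_end => /(congr1 snd)/rotation_inj/esym.
  by apply: dinj => //; exact: sqk.
Qed.

Lemma torus_map_image : torus_map @` tube_domain = @solid_torus R.
Proof.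
apply/seteqP; split=> [_ [q /tube_domainP[_ [pu pv]] <-]|[[x y] r] [/= xy rr]].
  by split; rewrite /torus_map ?rotation_norm ?disc_map_le1 //=; exact: cos2Dsin2.
have [a [/andP[a0 a2] ca sa]] := circle_surj xy.
have pp : 0 < pi *+ 2 :> R by rewrite mulrn_wgt0 // pi_gt0.
pose s := a / (pi *+ 2) * n%:R.
have sE : pi *+ 2 * (s / n%:R) = a.
  by rewrite /s mulfK // mulrC divfK // gt_eqF.
pose th := k%:R * (pi / 2) * (s / n%:R).
have [|p [pu pv pr]] := @disc_map_surj R (rotation (- th) r).
  by rewrite rotation_norm.
exists (s, p); last by rewrite /torus_map /= sE ca sa pr -/th rotationK.
apply/tube_domainP; split=> //=; rewrite /s mulr_ge0 ?divr_ge0 ?(ltW pp) //=.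
by rewrite ger_pMl ?ltr0n // ler_pdivrMr // mul1r.
Qed.

Lemma tube_map_image : tube_map @` tube_domain = mesh_body T.
Proof.
apply/seteqP; split=> [_ [[s p] /tube_domainP[/= sI sp] <-]|y [i _]].
  have [i [t t01 ->]] := segment_index n0 sI.
  by exists i => //; rewrite hull_tube_cell tube_mapE //; exists (t, p).
rewrite hull_tube_cell => -[[t p] /= [t01 sp] <-].
exists (i%:R + t, p); last by rewrite tube_mapE.
apply/tube_domainP; split=> //=; have [t0 t1] := andP t01.
rewrite addr_ge0 //= (@le_trans _ _ i.+1%:R) ?ler_nat //.
by rewrite -natr1 lerD2l.
Qed.

Hypothesis sT : closed_string T k.
Variable Omega : set V.
Hypothesis mT : hex_mesh T Omega.

(** The intersection is a common face, contained in the last section of one cell and in the first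
    section of the next. Coordinates within a cell are unique, which forces [t = 1] and [t' = 0]. *)
Lemma tube_cells_meet (i : 'I_n) t t' p p' : 0 <= t <= 1 -> 0 <= t' <= 1 ->
  square p -> square p' ->
  tube_cell i t p = tube_cell (ordS i) t' p' ->
  [/\ t = 1, t' = 0 & tube_section i.+1 p = tube_section (ordS i) p'].
Proof.
move=> t01 t01' sp sp' E.
have [D [F [x [y [mD mF Dx Fy]]]]] := string_meet mT sT i.
have meet : (closure (cell (T i)) `&` closure (cell (T (ordS i)))) (tube_cell i t p).
  rewrite !(closure_cell (mesh_hexahedron mT _)) !hull_tube_cell.
  by split; [exists (t, p)|exists (t', p')].
have := meet; rewrite mD => /(hull_tube_section Dx)[q sq].
have := meet; rewrite mF => /(hull_tube_section Fy)[q' sq'].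
rewrite addn1 addn0 => q'E qE.
have [t1 pq] : t = 1 /\ p = q.
  apply: (tube_cell_inj (ltn_ord i)) => //.
  by rewrite -qE /tube_cell scale1r subrr scale0r addr0.
have [t0 pq'] : t' = 0 /\ p' = q'.
  apply: (tube_cell_inj (ltn_ord (ordS i))) => //.
  by rewrite -E -q'E /tube_cell scale0r add0r subr0 scale1r.
by split=> //; rewrite pq pq' qE q'E.
Qed.

Lemma tube_section_inj j p p' : (j < n)%N ->
  tube_section j p = tube_section j p' -> p = p'.
Proof.
move=> jn E; have [] // := @tube_coordinates_inj j p p' 0 0 jn.
by rewrite E.
Qed.

Lemma tube_consecutive (i : 'I_n) t t' p p' : 0 <= t <= 1 -> 0 <= t' <= 1 ->
  square p -> square p' ->
  tube_map (i%:R + t, p) = tube_map ((ordS i)%:R + t', p') ->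
  same_fibre (i%:R + t, p) ((ordS i)%:R + t', p').
Proof.
move=> t01 t01' sp sp'; rewrite !tube_mapE // => /tube_cells_meet[] // -> -> E.
rewrite addr0; have [iN|iN] := eqVneq i.+1 n.
  have i0 : nat_of_ord (ordS i) = 0%N by rewrite /= iN modnn.
  constructor 2; rewrite /= iN modnn natr1 iN; split=> //.
  move: E; rewrite iN i0 wrap => /(tube_section_inj n0) <- //.
have iS : nat_of_ord (ordS i) = i.+1.
  by rewrite /= modn_small // ltn_neqAle iN ltn_ord.
constructor 1; rewrite iS natr1; congr pair.
by move: E; rewrite iS; apply: tube_section_inj; rewrite ltn_neqAle iN ltn_ord.
Qed.

Lemma same_fibre_tube q q' : tube_domain q -> tube_domain q' ->
  tube_map q = tube_map q' <-> same_fibre q q'.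
Proof.
case: q q' => [s p] [s' p'] /tube_domainP[/= sI sp] /tube_domainP[/= sI' sp'].
split; last first.
  case=> [->//|[/= -> -> ->]|[/= -> -> ->]].
    by rewrite tube_map_end tube_map_start wrap.
  by rewrite tube_map_end tube_map_start wrap.
have [i [t t01 sE]] := segment_index n0 sI.
have [j [t' t01' sE']] := segment_index n0 sI'.
rewrite sE sE'; have [<-|ij] := eqVneq i j.
  rewrite !tube_mapE // => /(tube_cell_inj (ltn_ord i) sp)[-> ->].
  by constructor 1.
have [->|jS] := eqVneq j (ordS i); first exact: tube_consecutive.
have [->|iS] := eqVneq i (ordS j).
  by move/esym/tube_consecutive => H; apply/same_fibre_sym/H.
rewrite !tube_mapE // => E; have [_ _ /(_ i j ij jS iS) /seteqP[+ _]] := sT.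
move=> /(_ (tube_cell i t p)); case.
rewrite !(closure_cell (mesh_hexahedron mT _)) !hull_tube_cell.
by split; [exists (t, p)|exists (t', p')].
Qed.

Lemma tube_toroidal : homeomorphic (mesh_body T) (@solid_torus R).
Proof.
rewrite -tube_map_image -torus_map_image.
apply: homeomorphic_images.
- exact: tube_domain_compact.
- exists (0, (0, 0)); apply/tube_domainP; rewrite /square /= lexx ler0n.
  by rewrite lerN10 ler01.
- exact: norm_hausdorff.
- exact: norm_hausdorff.
- exact: tube_map_continuous.
- exact: torus_map_continuous.
move=> q q' Kq Kq'; rewrite same_fibre_torus // same_fibre_tube //.
Qed.

End Tube.

(** * Tubes around lattice polygons *)

Definition scalep (m : int) (p : point) : point := (m * p.1.1, m * p.1.2, m * p.2).

(* Vertices of the closed polygon with sides [s], and the two half diagonals of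
   the section of the tube in the mitre plane at each vertex.  A section is
   carried along a side by projection in the direction of the side, so a
   polygon that is not plane may return the first section rotated. *)
Definition lattice_polygon : Type := seq (point * int).

Definition side_direction (s : lattice_polygon) j : point :=
  (nth ((0, 0, 0), 0) s (j %% size s)).1.

Definition side_length (s : lattice_polygon) j : int :=
  (nth ((0, 0, 0), 0) s (j %% size s)).2.

(** The mitre plane at the next vertex is orthogonal to the sum of the two side directions. These
    are orthogonal unit vectors in the polygons below, so adding this multiple of the direction
    brings [p] into that plane. *)
Definition mitre (s : lattice_polygon) j (p : point) : int :=
  - dot p (addp (side_direction s j) (side_direction s j.+1)).

Fixpoint polygon_vertex (s : lattice_polygon) j : point :=
  if j is j'.+1 then
    addp (polygon_vertex s j') (scalep (side_length s j') (side_direction s j'))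
  else (0, 0, 0).

Fixpoint polygon_frame (s : lattice_polygon) (p : point) j : point :=
  if j is j'.+1 then let q := polygon_frame s p j' in
    addp q (scalep (mitre s j' q) (side_direction s j'))
  else p.

(** The mitre plane at vertex 0 is spanned by the cross product and the difference of the two
    directions. Exchanging these vectors by [flip] reverses the handedness of the labels, so that
    the polygon for one quarter turn also serves for three. *)
Definition tube_frame (flip : bool) (s : lattice_polygon) (first : bool) j : point :=
  let d := side_direction s (size s).-1 in let d' := side_direction s 0 in
  polygon_frame s (if first (+) flip then crossp d d' else addp d' (oppp d)) j.

Definition int_sign (b : bool) : int := if b then 1%Z else (-1)%Z.

Definition tube_table flip s (i : nat) : table := fun z =>
  let j := (i + z.2)%N in
  addp (polygon_vertex s j) (addp (scalep (int_sign z.1.1) (tube_frame flip s true j))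
    (scalep (int_sign z.1.2) (tube_frame flip s false j))).

Definition turn_pair (ef : point * point) : point * point := (ef.2, oppp ef.1).

Definition turn_label (z : label) : label := (~~ z.1.2, z.1.1, z.2).

Definition tube_ok flip s : bool :=
  all (fun j =>
    let e := tube_frame flip s true j in let f := tube_frame flip s false j in
    let d := side_direction s j in
    [&& (absz (mitre s j e) + absz (mitre s j f) < absz (side_length s j))%N,
      0 < side_length s j, dot (crossp f d) e != 0, dot (crossp e d) f != 0 &
      dot (crossp e f) d != 0]) (iota 0 (size s)).

Definition closed_ok k flip s : bool :=
  let n := size s in
  (polygon_vertex s n == (0, 0, 0)) &&
  ((tube_frame flip s true n, tube_frame flip s false n) ==
    iter k turn_pair (tube_frame flip s true 0, tube_frame flip s false 0)).

Definition string_ok n cands k (ts : nat -> table) : bool :=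
  [&& all (fun i => (i.+1 == n) ||
        all (fun z => ts i (z.1, true) == ts i.+1 (z.1, false)) labels) (iota 0 n),
      all (fun z => ts n.-1 (z.1, true) ==
        ts 0%N ((iter k turn_label z).1, false)) labels &
      all (fun i => all (fun j => [|| i == j, j == (i.+1 %% n)%N, i == (j.+1 %% n)%N |
        disjoint_ok cands (ts i) (ts j)]) (iota 0 n)) (iota 0 n)].

Section LatticeTubes.
Variable R : realType.

Lemma label_of_setc x b : label_of (setc x string_axis b) = ((label_of x).1, b).
Proof. by rewrite /label_of setc_same !ffunE. Qed.

Lemma label_of_turn k x :
  label_of (iter k quarter_turn x) = iter k turn_label (label_of x).
Proof. by elim: k => //= k <-; rewrite /label_of !ffunE. Qed.

Lemma string_okP n cands k ts : mesh_ok n cands ts -> string_ok n cands k ts ->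
  closed_string (@hexas_of R n ts) k.
Proof.
move=> mok /and3P[/allP att /allP last /allP dis]; split.
- move=> i x iN; have := att i; rewrite mem_iota ltn_ord => /(_ isT).
  rewrite ltn_eqF // orFb => /allP/(_ _ (mem_labels (label_of x)))/eqP E.
  by rewrite /hexas_of /hexa_of !label_of_setc E /= modn_small.
- move=> i x iN; have := last _ (mem_labels (label_of x)) => /eqP.
  rewrite (congr1 predn (esym iN) : n.-1 = i) => E.
  by rewrite /hexas_of /hexa_of !label_of_setc label_of_turn /= iN modnn -E.
- move=> i j ij jS iS; have := dis i; rewrite mem_iota ltn_ord => /(_ isT).
  move=> /allP/(_ j); rewrite mem_iota ltn_ord => /(_ isT).
  rewrite val_eqE (negbTE ij) /=.
  have -> : (val j == (i.+1 %% n)%N) = false by apply/negbTE; rewrite -val_eqE in jS.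
  have -> : (val i == (j.+1 %% n)%N) = false by apply/negbTE; rewrite -val_eqE in iS.
  move=> /hasP[a _ /strictly_bounded_byP].
  by rewrite !(closure_cell (mesh_ok_is_hexahedron R mok _)); apply.
Qed.

Lemma vec_scale m p : vec R (scalep m p) = m%:~R *: vec R p.
Proof. by apply/rowP => -[[|[|[|//]]] lt3]; rewrite !mxE /= intrM. Qed.

Lemma dot_cross1 (p q : point) : dot (crossp p q) p = 0.
Proof. by rewrite /dot /crossp /=; ring. Qed.

Lemma dot_cross2 (p q : point) : dot (crossp p q) q = 0.
Proof. by rewrite /dot /crossp /=; ring. Qed.

Section LatticeTube.
Variables (flip : bool) (s : lattice_polygon) (k : nat).
Hypotheses (s0 : (0 < size s)%N) (ok : tube_ok flip s) (cok : closed_ok k flip s).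

Let n := size s.
Let T : hexas R n := hexas_of R (tube_table flip s).
Let c j : 'rV[R]_3 := vec R (polygon_vertex s j).
Let e b j : 'rV[R]_3 := vec R (tube_frame flip s b j).

(** Turning the two vectors amounts to turning the coordinates. *)
Lemma turn_pair_section p (ef : point * point) m :
  p.1 *: vec R (iter m turn_pair ef).1 + p.2 *: vec R (iter m turn_pair ef).2 =
  (iter m (@quarter R) p).1 *: vec R ef.1 + (iter m (@quarter R) p).2 *: vec R ef.2.
Proof.
elim: m p => // m IHm p; rewrite [in RHS]iterSr -IHm /= vecN /quarter /=.
by rewrite addrC scalerN scaleNr.
Qed.

Lemma lattice_tube_toroidal Omega : closed_string T k -> hex_mesh T Omega ->
  homeomorphic (mesh_body T) (@solid_torus R).
Proof.
move=> sT mT; have jn j : (j < n)%N -> j \in iota 0 n by rewrite mem_iota.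
apply: (@tube_toroidal R n k T c (e true) (e false) (fun j => vec R (side_direction s j))
  (fun j => (side_length s j)%:~R) (fun j => (mitre s j (tube_frame flip s true j))%:~R)
  (fun j => (mitre s j (tube_frame flip s false j))%:~R) s0 _ _ _ _ _ _ _ sT Omega mT).
- move=> i x; rewrite /T /hexas_of /hexa_of /tube_table /tube_section /= !vecD !vec_scale addrA.
  by congr (_ + _ *: _ + _ *: _); rewrite /sign_of /int_sign; case: (x _).
- by move=> j _; rewrite /c /= vecD vec_scale.
- by move=> j _; rewrite /e /tube_frame /= vecD vec_scale.
- by move=> j _; rewrite /e /tube_frame /= vecD vec_scale.
- move=> j /jn/(allP ok)/= /and5P[lt l0 _ _ _].
  rewrite -!intr_norm -intrD ltr_int -(gtr0_norm l0) -!abszE -PoszD ltz_nat //.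
- move=> j /jn/(allP ok)/= /and5P[_ _ de df dd].
  exists (covec R (crossp (tube_frame flip s false j) (side_direction s j))),
    (covec R (crossp (tube_frame flip s true j) (side_direction s j))),
    (covec R (crossp (tube_frame flip s true j) (tube_frame flip s false j))).
  by rewrite !lf_vec !intr_eq0 !dot_cross1 !dot_cross2.
- move=> p; case/andP: cok => /eqP cn /eqP efn.
  rewrite /tube_section /c /e /n cn -!addrA; congr (_ + _).
  have := turn_pair_section p (tube_frame flip s true 0, tube_frame flip s false 0) k.
  by rewrite -efn.
Qed.

End LatticeTube.
End LatticeTubes.

(** * Polygons for the four twists *)

Definition unit_x : point := (1, 0, 0)%Z.
Definition unit_y : point := (0, 1, 0)%Z.
Definition unit_z : point := (0, 0, 1)%Z.

(** The tubes have half-width 1; sides of length at least 4 leave room for the mitres at both ends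
    and keep cells that are not consecutive apart. *)
Definition tube0 : lattice_polygon :=
  [:: (unit_x, 4%Z); (unit_y, 4%Z); (oppp unit_x, 4%Z); (oppp unit_y, 4%Z)].
Definition tube1 : lattice_polygon :=
  [:: (unit_x, 4%Z); (unit_y, 4%Z); (unit_x, 4%Z); (oppp unit_y, 4%Z); (unit_z, 4%Z);
      (oppp unit_x, 8%Z); (oppp unit_z, 4%Z)].
Definition tube2 : lattice_polygon :=
  [:: (unit_x, 4%Z); (unit_y, 4%Z); (unit_x, 8%Z); (oppp unit_y, 4%Z); (oppp unit_x, 4%Z);
      (unit_z, 4%Z); (oppp unit_x, 8%Z); (oppp unit_z, 4%Z)].

Definition tube_normals : seq point :=
  let l := [:: (1, 1, 0); (0, 0, 1); (1, 0, 0); (1, 0, -1); (1, -1, 0); (1, 0, 1);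
               (0, 1, -1); (0, 1, 0)]%Z in l ++ map oppp l.

Definition string_certificate k flip s : bool :=
  let ts := tabulate (size s) (tube_table flip s) in
  [&& (0 < size s)%N, mesh_ok (size s) tube_normals ts,
    string_ok (size s) tube_normals k ts, tube_ok flip s & closed_ok k flip s].

Lemma certified_string (R : realType) k flip s : string_certificate k flip s ->
  exists (n : nat) (T : hexas R n) (Omega : set 'rV[R]_3),
    [/\ hex_mesh T Omega, toroidal Omega & closed_string T k].
Proof.
move=> /and5P[s0 mok sok ok cok].
have mT := mesh_okP R mok s0; have sT := string_okP R mok sok.
have hT := mesh_ok_is_hexahedron R mok.
rewrite hexas_of_tabulate in mT sT hT.
exists (size s), (hexas_of R (tube_table flip s)),
  (mesh_body (@hexas_of R (size s) (tube_table flip s)))°; split=> //.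
rewrite /toroidal (closure_mesh_body_interior hT).
exact: (lattice_tube_toroidal s0 ok cok sT mT).
Qed.

Lemma tube0_certificate : string_certificate 0 false tube0.
Proof. by vm_compute. Qed.

Lemma tube1_certificate : string_certificate 1 false tube1.
Proof. by vm_compute. Qed.

Lemma tube2_certificate : string_certificate 2 false tube2.
Proof. by vm_compute. Qed.

Lemma tube3_certificate : string_certificate 3 true tube1.
Proof. by vm_compute. Qed.

Unset Implicit Arguments.

Theorem mainTheorem3 (R : realType) :
  ~ (forall (n : nat) (T : hexas R n) (Omega : set 'rV[R]_3),
       hex_mesh T Omega -> consistently_orientable T) /\
  (exists (n : nat) (T : hexas R n) (Omega : set 'rV[R]_3),
     [/\ hex_mesh T Omega, toroidal Omega & ~ consistently_orientable T]) /\
  (forall k : nat, (k < 4)%N ->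
     exists (n : nat) (T : hexas R n) (Omega : set 'rV[R]_3),
       [/\ hex_mesh T Omega, toroidal Omega & closed_string T k]) /\
  (forall (n : nat) (T : hexas R n) (Omega : set 'rV[R]_3),
     hex_mesh T Omega ->
     [/\ closed_string T 0 -> consistently_orientable T,
         closed_string T 2 -> ~ consistently_orientable T &
         closed_string T 1 \/ closed_string T 3 ->
           ~ consistently_orientable T]) /\
  (exists (T : hexas R 14) (Omega : set 'rV[R]_3),
     [/\ hex_mesh T Omega, simply_connected Omega, without_holes Omega &
         ~ consistently_orientable T]).
Proof.
split; [|split; [|split; [|split]]].
- move=> orientable; have [T [W [mT _ _ no]]] := nonorientable_ball R.
  exact/no/orientable/mT.
(* The toroidal example is the string with the twist by 180 degrees. *)
- have [n [T [W [mT tT sT]]]] := certified_string R tube2_certificate.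
  by exists n, T, W; split=> //; apply: (twisted_string_not_orientable mT sT).
- case=> [|[|[|[|//]]]] _.
  + exact: certified_string tube0_certificate.
  + exact: certified_string tube1_certificate.
  + exact: certified_string tube2_certificate.
  + exact: certified_string tube3_certificate.
- move=> n T Omega mT; split=> [sT|sT|[sT|sT]].
  + exact: (untwisted_string_orientable mT sT).
  + exact: (twisted_string_not_orientable mT sT).
  + exact: (twisted_string_not_orientable mT sT).
  + exact: (twisted_string_not_orientable mT sT).
- exact: nonorientable_ball.
Qed.
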